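(* Let $\Lambda_{ABC}$ be any ES-box (respectively, any GHZ-EPR box), and let $\tilde\Lambda_{ABC}=\Lambda^T_{AB}\circ\Lambda_{ABC}$ be the map obtained by applying the $UU^*$-twirling $\Lambda_{AB}^T$ to its output. Then $\tilde\Lambda_{ABC}$ is again an ES-box (respectively, a GHZ-EPR box), its communication value in the direction $C\to AB$ is equal to $1$, and it is non-signalling with respect to $C\to A$ and with respect to $C\to B$.
   Context: Three parties: Alice ($A$), Bob ($B$), Charlie ($C$). Notation: $|\Psi^+\rangle_{XY}=\frac1{\sqrt2}(|00\rangle+|11\rangle)$ (EPR pair of two qubits), $|GHZ\rangle_{ABC}=\frac1{\sqrt2}(|000\rangle+|111\rangle)$. A tripartite LOCC operation $\Lambda_{ABC}$ is a quantum channel (completely positive trace-preserving map) implemented by Alice, Bob and Charlie by rounds of local quantum operations and classical communication among them, with no pre-shared entanglement. Alice's and Bob's systems are qubits both at input and at output. An LOCC operation is called: - an ES-box (entanglement swapping) if Charlie's input system consists of two qubits $C=C_1C_2$ and the input $|\Psi^+\rangle_{AC_1}|\Psi^+\rangle_{BC_2}$ is mapped to the output $|\Psi^+\rangle_{AB}$; - a GHZ-EPR box if Charlie's input system is one qubit and the input $|GHZ\rangle_{ABC}$ is mapped to the output $|\Psi^+\rangle_{AB}$. For these boxes only the $AB$ output is considered: Charlie's output system is traced out. No requirement is made on the action of the box on other inputs. $UU^*$-twirling on two qubits: $\Lambda_{AB}^T(\sigma_{AB})=\int dU\,(U_A\otimes U_B^* )\,\sigma_{AB}\,(U_A\otimes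 U_B^* )^\dagger$, where $dU$ is the normalized Haar measure on the unitary group $U(2)$ and $U^*$ is the entrywise complex conjugate of $U$ in the computational basis. Communication value (CV) of a box, in the direction $C\to AB$: the maximal asymptotic rate (capacity), in classical bits per use of the box, at which the user Charlie can reliably (with error probability vanishing as the number $n$ of uses tends to infinity) send classical messages to the users Alice and Bob by means of $n$ uses of the box. Here Alice and Bob are regarded as a single party that may perform arbitrary joint quantum operations; the users may consume an arbitrary amount of pre-shared entanglement and use local ancillas, and may feed any (message-independent, shared) input state into the box, with Charlie applying message-dependent local operations on his systems; apart from the box there is no communication between Charlie and Alice–Bob. Signalling: a map $\Lambda$ is signalling from $C$ to $A$ if there exist a state $\rho_{ABC}$ and two quantum operations (channels) $\Gamma^0,\Gamma^1$ acting on $C$ alone such that the reduced states on $A$ of $\Lambda(\Gamma^0[\rho])$ and $\Lambda(\Gamma^1[\rho])$ differ; otherwise it is non-signalling with respect to $C\to A$. Similarly for $C\to B$. *)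

(* Defs.v *)
From HB Require Import structures.
From mathcomp Require Import all_boot all_order all_algebra.
From mathcomp Require Import complex.
From mathcomp Require Import all_classical all_reals all_analysis.

Set Implicit Arguments.
Unset Strict Implicit.
Unset Printing Implicit Defensive.

Import Order.TTheory GRing.Theory Num.Theory numFieldNormedType.Exports.

Local Open Scope classical_set_scope.
Local Open Scope ring_scope.
Local Open Scope complex_scope.
Local Open Scope sesquilinear_scope.

(* A quantum system is described by a finite type X of labels of its
   computational basis: its Hilbert space is C^X, and the composite of the
   systems X and Y is (X * Y)%type, so that a tensor product never requires
   a cast between dimensions. *)

Definition op (R : realType) (X : finType) := 'M[R[i]]_#|X|.

Definition opmx (R : realType) (X : finType) (f : X -> X -> R[i]) : op R X :=
  \matrix_(i, j) f (enum_val i) (enum_val j).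

Definition entry (R : realType) (X : finType) (rho : op R X) (x y : X) : R[i] :=
  rho (enum_rank x) (enum_rank y).

Definition ket (R : realType) (X : finType) (f : X -> R[i]) : 'cV[R[i]]_#|X| :=
  \col_i f (enum_val i).

Definition pure (R : realType) (X : finType) (f : X -> R[i]) : op R X :=
  ket f *m (ket f)^t*.

(* 0 <= z in R[i] means that z is real and nonnegative, so Hermitian symmetry
   is implied. *)
Definition psd (R : realType) (X : finType) (rho : op R X) : Prop :=
  forall v : 'cV[R[i]]_#|X|, 0 <= (v^t* *m rho *m v) 0 0.

Definition density (R : realType) (X : finType) (rho : op R X) : Prop :=
  psd rho /\ \tr rho = 1.

Definition ptrace_r (R : realType) (X Y : finType)
    (rho : op R (X * Y)%type) : op R X :=
  opmx (fun x x' => \sum_(y : Y) entry rho (x, y) (x', y)).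

Definition ptrace_l (R : realType) (X Y : finType)
    (rho : op R (X * Y)%type) : op R Y :=
  opmx (fun y y' => \sum_(x : X) entry rho (x, y) (x, y')).

(* Phi (x) id_Z: the linear map Phi acts on each of the (z, z') blocks of rho. *)
Definition tens_id (R : realType) (X Y Z : finType) (Phi : op R X -> op R Y)
    (rho : op R (X * Z)%type) : op R (Y * Z)%type :=
  opmx (fun yz yz' =>
    entry (Phi (opmx (fun x x' => entry rho (x, yz.2) (x', yz'.2)))) yz.1 yz'.1).

Definition id_tens (R : realType) (X Y Z : finType) (Phi : op R X -> op R Y)
    (rho : op R (Z * X)%type) : op R (Z * Y)%type :=
  opmx (fun zy zy' =>
    entry (Phi (opmx (fun x x' => entry rho (zy.1, x) (zy'.1, x')))) zy.2 zy'.2).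

Definition completely_positive (R : realType) (X Y : finType)
    (Phi : op R X -> op R Y) : Prop :=
  linear Phi /\
  forall (Z : finType) (rho : op R (X * Z)%type), psd rho -> psd (tens_id Phi rho).

Definition channel (R : realType) (X Y : finType) (Phi : op R X -> op R Y) : Prop :=
  completely_positive Phi /\ forall rho, \tr (Phi rho) = \tr rho.

(* The post-measurement system Y i may depend on the outcome i. *)
Definition instrument (R : realType) (X I : finType) (Y : I -> finType)
    (Phi : forall i, op R X -> op R (Y i)) : Prop :=
  (forall i, completely_positive (Phi i)) /\
  forall rho, \sum_i \tr (Phi i rho) = \tr rho.

Definition actA (R : realType) (A B C A' : finType) (Phi : op R A -> op R A')
    (rho : op R (A * B * C)%type) : op R (A' * B * C)%type :=
  opmx (fun '(a, b, c) '(a', b', c') =>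
    entry (Phi (opmx (fun x x' => entry rho (x, b, c) (x', b', c')))) a a').

Definition actB (R : realType) (A B C B' : finType) (Phi : op R B -> op R B')
    (rho : op R (A * B * C)%type) : op R (A * B' * C)%type :=
  opmx (fun '(a, b, c) '(a', b', c') =>
    entry (Phi (opmx (fun x x' => entry rho (a, x, c) (a', x', c')))) b b').

Definition actC (R : realType) (A B C C' : finType) (Phi : op R C -> op R C')
    (rho : op R (A * B * C)%type) : op R (A * B * C')%type :=
  opmx (fun '(a, b, c) '(a', b', c') =>
    entry (Phi (opmx (fun x x' => entry rho (a, b, x) (a', b', x')))) c c').

(* Finite-round LOCC protocols with final systems A', B', C'.  In a round one
   party applies a local instrument and broadcasts its outcome i, and the three
   parties go on with a protocol that may depend on i; the resulting map is
   averaged over the (finally discarded) classical record. *)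
Inductive locc (R : realType) (A' B' C' : finType) :
    forall A B C : finType,
      (op R (A * B * C)%type -> op R (A' * B' * C')%type) -> Prop :=
| locc_done : @locc R A' B' C' A' B' C' id
| locc_A (A B C I : finType) (A1 : I -> finType)
    (Phi : forall i, op R A -> op R (A1 i))
    (next : forall i, op R (A1 i * B * C)%type -> op R (A' * B' * C')%type) :
    instrument Phi -> (forall i, locc (next i)) ->
    @locc R A' B' C' A B C (fun rho => \sum_i next i (actA (Phi i) rho))
| locc_B (A B C I : finType) (B1 : I -> finType)
    (Phi : forall i, op R B -> op R (B1 i))
    (next : forall i, op R (A * B1 i * C)%type -> op R (A' * B' * C')%type) :
    instrument Phi -> (forall i, locc (next i)) ->
    @locc R A' B' C' A B C (fun rho => \sum_i next i (actB (Phi i) rho))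
| locc_C (A B C I : finType) (C1 : I -> finType)
    (Phi : forall i, op R C -> op R (C1 i))
    (next : forall i, op R (A * B * C1 i)%type -> op R (A' * B' * C')%type) :
    instrument Phi -> (forall i, locc (next i)) ->
    @locc R A' B' C' A B C (fun rho => \sum_i next i (actC (Phi i) rho)).

Definition qubit : finType := 'I_2.

Definition inv_sqrt2 (R : realType) : R[i] := (Num.sqrt (2 : R))^-1%:C.

Definition epr_amp (R : realType) (xy : qubit * qubit) : R[i] :=
  if xy.1 == xy.2 then inv_sqrt2 R else 0.

Definition epr (R : realType) : op R (qubit * qubit)%type := pure (@epr_amp R).

(* |Psi+>_{A C1} |Psi+>_{B C2} *)
Definition es_input (R : realType) : op R (qubit * qubit * (qubit * qubit))%type :=
  pure (fun '(a, b, (c1, c2)) => epr_amp R (a, c1) * epr_amp R (b, c2)).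

Definition ghz (R : realType) : op R (qubit * qubit * qubit)%type :=
  pure (fun '(a, b, c) => if (a == b) && (b == c) then inv_sqrt2 R else 0).

Definition ES_box (R : realType) (C' : finType)
    (L : op R (qubit * qubit * (qubit * qubit))%type ->
         op R (qubit * qubit * C')%type) : Prop :=
  locc L /\ ptrace_r (L (es_input R)) = epr R.

Definition GHZ_EPR_box (R : realType) (C' : finType)
    (L : op R (qubit * qubit * qubit)%type ->
         op R (qubit * qubit * C')%type) : Prop :=
  locc L /\ ptrace_r (L (ghz R)) = epr R.

Definition U2 (R : realType) := {U : 'M[R[i]]_2 | U \is unitarymx}.

Lemma unitarymx1 (R : realType) : (1%:M : 'M[R[i]]_2) \is unitarymx.
Proof. by apply/unitarymxP; rewrite trmx1 map_mx1 mulmx1. Qed.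

HB.instance Definition _ (R : realType) := Choice.on (U2 R).
HB.instance Definition _ (R : realType) :=
  isPointed.Build (U2 R) (exist _ 1%:M (unitarymx1 R)).

(* Open sets of U(2) for the topology induced by that of the 2 x 2 complex
   matrices; R[i]^o is R[i] with the topology of its modulus. *)
Definition U2_open (R : realType) : set (set (U2 R)) :=
  [set S | exists2 O : set 'M[R[i]^o]_2, open O & S = [set U | O (val U)]].

Definition U2_borel (R : realType) := g_sigma_algebraType (@U2_open R).

Definition U2_mul (R : realType) (V U : U2 R) : U2 R :=
  exist _ (val V *m val U) (mul_unitarymx (valP V) (valP U)).

(* The normalized Haar measure is the left-invariant Borel probability. *)
Definition is_haar (R : realType) (mu : probability (U2_borel R) R) : Prop :=
  forall (V : U2 R) (S : set (U2_borel R)), measurable S ->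
    mu (U2_mul V @^-1` S) = mu S.

Definition cintegral (R : realType) (mu : probability (U2_borel R) R)
    (f : U2 R -> R[i]) : R[i] :=
  (\int[mu]_U complex.Re (f U)) +i* (\int[mu]_U complex.Im (f U)).

Definition U_Uconj (R : realType) (U : U2 R) : op R (qubit * qubit)%type :=
  opmx (fun '(a, b) '(a', b') => val U a a' * Num.conj (val U b b')).

Definition twirl (R : realType) (mu : probability (U2_borel R) R)
    (sigma : op R (qubit * qubit)%type) : op R (qubit * qubit)%type :=
  \matrix_(i, j) cintegral mu
    (fun U => (U_Uconj U *m sigma *m (U_Uconj U)^t*) i j).

Definition twirled (R : realType) (mu : probability (U2_borel R) R)
    (A B C C' : finType)
    (L : op R (A * B * C)%type -> op R (qubit * qubit * C')%type) :
    op R (A * B * C)%type -> op R (qubit * qubit * C')%type :=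
  fun rho => tens_id (twirl mu) (L rho).

Definition signalling_CA (R : realType) (A B C A' B' C' : finType)
    (L : op R (A * B * C)%type -> op R (A' * B' * C')%type) : Prop :=
  exists (rho : op R (A * B * C)%type) (G0 G1 : op R C -> op R C),
    [/\ density rho, channel G0, channel G1 &
        ptrace_r (ptrace_r (L (actC G0 rho))) <>
        ptrace_r (ptrace_r (L (actC G1 rho)))].

Definition signalling_CB (R : realType) (A B C A' B' C' : finType)
    (L : op R (A * B * C)%type -> op R (A' * B' * C')%type) : Prop :=
  exists (rho : op R (A * B * C)%type) (G0 G1 : op R C -> op R C),
    [/\ density rho, channel G0, channel G1 &
        ptrace_l (ptrace_r (L (actC G0 rho))) <>
        ptrace_l (ptrace_r (L (actC G1 rho)))].

(* One use of N : S C -> S', with sender system C and joint receiver systems S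
   and S', on a state of (S X)(C Y), where X and Y are the memories of the
   receiver and of the sender. *)
Definition use_box (R : realType) (S C S' X Y : finType)
    (N : op R (S * C)%type -> op R S')
    (rho : op R ((S * X) * (C * Y))%type) : op R ((S' * X) * Y)%type :=
  opmx (fun '(s, x, y) '(s', x', y') =>
    entry (N (opmx (fun '(t, c) '(t', c') =>
      entry rho ((t, x), (c, y)) ((t', x'), (c', y'))))) s s').

(* [transmission N n st] : the family st of states (one for each message m),
   shared by the receiver (left factor) and the sender (right factor), can be
   prepared with n uses of N, from an arbitrary message-independent shared
   state, by local operations which for the sender may depend on m.  The uses
   may be fed with parts of one joint state, or be adaptive. *)
Inductive transmission (R : realType) (M : Type) (S C S' : finType)
    (N : op R (S * C)%type -> op R S') :
    nat -> forall X Y : finType, (M -> op R (X * Y)%type) -> Prop :=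
| tr_start (X Y : finType) (rho : op R (X * Y)%type) :
    density rho -> @transmission R M S C S' N 0 X Y (fun=> rho)
| tr_receiver n (X Y X' : finType) (st : M -> op R (X * Y)%type)
    (Phi : op R X -> op R X') :
    transmission N n st -> channel Phi ->
    @transmission R M S C S' N n X' Y (fun m => tens_id Phi (st m))
| tr_sender n (X Y Y' : finType) (st : M -> op R (X * Y)%type)
    (Phi : M -> op R Y -> op R Y') :
    transmission N n st -> (forall m, channel (Phi m)) ->
    @transmission R M S C S' N n X Y' (fun m => id_tens (Phi m) (st m))
| tr_use n (X Y : finType) (st : M -> op R ((S * X) * (C * Y))%type) :
    transmission N n st ->
    @transmission R M S C S' N n.+1 (S' * X)%type Y (fun m => use_box N (st m)).

(* Every one of the M messages is decoded by the POVM D with error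
   probability at most e. *)
Definition reliable_code (R : realType) (S C S' : finType)
    (N : op R (S * C)%type -> op R S') (n M : nat) (e : R) : Prop :=
  exists (X Y : finType) (st : 'I_M -> op R (X * Y)%type) (D : 'I_M -> op R X),
    [/\ transmission N n st,
        forall m, psd (D m),
        \sum_m D m = 1%:M &
        forall m, (1 - e)%:C <= \tr (D m *m ptrace_r (st m))].

Definition achievable (R : realType) (S C S' : finType)
    (N : op R (S * C)%type -> op R S') (r : R) : Prop :=
  exists (M : nat -> nat) (e : nat -> R),
    [/\ forall n, reliable_code N n (M n) (e n),
        e @ \oo --> (0 : R) &
        \forall n \near \oo, 2 `^ (r * n%:R) <= (M n)%:R].

(* The receiver is Alice and Bob together; Charlie's output is traced out. *)
Definition communication_value (R : realType) (A B C A' B' C' : finType)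
    (L : op R (A * B * C)%type -> op R (A' * B' * C')%type) : \bar R :=
  ereal_sup [set r%:E | r in
    [set r | achievable (fun rho : op R (A * B * C)%type => ptrace_r (L rho)) r]].

(* Main.v *)
Require Import Defs.
From HB Require Import structures.
From mathcomp Require Import all_boot all_order all_algebra.
From mathcomp Require Import complex.
From mathcomp Require Import all_classical all_reals all_analysis.
From mathcomp Require Import measurable_realfun ring lra.

Set Implicit Arguments.
Unset Strict Implicit.
Unset Printing Implicit Defensive.

Import Order.TTheory GRing.Theory Num.Theory numFieldNormedType.Exports.

Local Open Scope classical_set_scope.
Local Open Scope ring_scope.
Local Open Scope complex_scope.
Local Open Scope sesquilinear_scope.

(* The Haar twirl equals the isotropic map s |-> F E0 + (tr s - F) E1, where
   E0 = |Psi+><Psi+|, E1 = (1 - E0)/3 and F = tr (E0 s): the twirl of s is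
   invariant under every U (x) U^*, hence under averaging over Z, over X and
   over the powers of an order 3 Clifford unitary, and that finite average,
   which is an LOCC map, is the isotropic map.  So the twirled box remains LOCC,
   and both marginals of its output are maximally mixed (no signalling).

   The twirled box emits one of the two orthogonal states E0, E1, so it is
   dominated by twice a constant channel; after n uses the state of message m
   is at most 2^n times a state whose receiver part does not depend on m.
   Hence M (1 - e) <= 2^n for M messages and error e, and the rate is at most 1.

   The rate 1 is reached without error: Charlie feeds the reference input or
   the same input with a Z applied to C2 (ES) or C (GHZ).  A Kraus operator
   A (x) B (x) C of the box, restricted to one basis vector of C', maps the
   reference input to (the vector of) w = A G B^T and the flipped one to
   w' = A G Z B^T.  As the box outputs Psi+ on the former, w = l 1; if l != 0
   then w' is similar to l Z, so it is traceless, i.e. orthogonal to Psi+, and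
   |w'|^2 >= 2 |det w'| = |w|^2.  By trace preservation all these inequalities
   are equalities, so w' = 0 when l = 0, and the flipped output is orthogonal
   to Psi+: the twirled box returns exactly E1. *)

(** * Entries and positivity *)

Section Entries.
Variable R : realType.
Implicit Types X Y Z : finType.
Local Notation conj := (@Num.conj R[i]).

Lemma entry_opmx X (f : X -> X -> R[i]) x y : entry (opmx f) x y = f x y.
Proof. by rewrite /entry mxE !enum_rankK. Qed.

Lemma entry_ext X (a b : op R X) :
  (forall x y, entry a x y = entry b x y) -> a = b.
Proof.
move=> h; apply/matrixP => i j.
by have := h (enum_val i) (enum_val j); rewrite /entry !enum_valK.
Qed.

Lemma eq_opmx X (f g : X -> X -> R[i]) :
  (forall x y, f x y = g x y) -> opmx f = opmx g.
Proof. by move=> h; apply: entry_ext => x y; rewrite !entry_opmx. Qed.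

Lemma opmxK X (a : op R X) : opmx (entry a) = a.
Proof. by apply: entry_ext => x y; rewrite entry_opmx. Qed.

Lemma entryD X (a b : op R X) x y : entry (a + b) x y = entry a x y + entry b x y.
Proof. by rewrite /entry mxE. Qed.

Lemma entryN X (a : op R X) x y : entry (- a) x y = - entry a x y.
Proof. by rewrite /entry mxE. Qed.

Lemma entryZ X c (a : op R X) x y : entry (c *: a) x y = c * entry a x y.
Proof. by rewrite /entry mxE. Qed.

Lemma entry0 X x y : entry (0 : op R X) x y = 0.
Proof. by rewrite /entry mxE. Qed.

Lemma entry1 X x y : entry (1%:M : op R X) x y = (x == y)%:R.
Proof. by rewrite /entry mxE (inj_eq enum_rank_inj). Qed.

Lemma entry_sum X I (s : seq I) (P : pred I) (F : I -> op R X) x y :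
  entry (\sum_(i <- s | P i) F i) x y = \sum_(i <- s | P i) entry (F i) x y.
Proof. by rewrite /entry summxE. Qed.

Lemma big_ord_fin X (F : 'I_#|X| -> R[i]) : \sum_i F i = \sum_x F (enum_rank x).
Proof. by rewrite (reindex (@enum_rank X)) //; apply/onW_bij/enum_rank_bij. Qed.

Lemma entryM X (a b : op R X) x y :
  entry (a *m b) x y = \sum_z entry a x z * entry b z y.
Proof. by rewrite /entry mxE big_ord_fin. Qed.

Lemma entry_adj X (a : op R X) x y : entry (a^t*) x y = conj (entry a y x).
Proof. by rewrite /entry !mxE. Qed.

Lemma entry_pure X (f : X -> R[i]) x y : entry (pure f) x y = f x * conj (f y).
Proof. by rewrite /entry /pure mxE big_ord1 !mxE !enum_rankK. Qed.

Lemma trE X (a : op R X) : \tr a = \sum_x entry a x x.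
Proof. by rewrite /mxtrace big_ord_fin. Qed.

Lemma psdE X (a : op R X) : psd a <->
  forall v : X -> R[i], 0 <= \sum_x \sum_y conj (v x) * entry a x y * v y.
Proof.
have E (w : 'cV[R[i]]_#|X|) : (w^t* *m a *m w) 0 0 =
   \sum_x \sum_y conj (w (enum_rank x) 0) * entry a x y * w (enum_rank y) 0.
  rewrite mxE big_ord_fin exchange_big; apply: eq_bigr => y _ /=.
  by rewrite mxE big_ord_fin mulr_suml; apply: eq_bigr => x _; rewrite !mxE.
split=> [h v|h w]; last by rewrite E.
have := h (ket v); rewrite E; congr (0 <= _).
by apply: eq_bigr => x _; apply: eq_bigr => y _; rewrite !mxE !enum_rankK.
Qed.

Lemma psdD X (a b : op R X) : psd a -> psd b -> psd (a + b).
Proof.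
move=> /psdE ha /psdE hb; apply/psdE => v.
have := addr_ge0 (ha v) (hb v); rewrite -big_split /=; congr (0 <= _).
apply: eq_bigr => x _; rewrite -big_split /=; apply: eq_bigr => y _.
by rewrite entryD mulrDr mulrDl.
Qed.

Lemma psdZ X c (a : op R X) : 0 <= c -> psd a -> psd (c *: a).
Proof.
move=> hc /psdE ha; apply/psdE => v.
have := mulr_ge0 hc (ha v); rewrite mulr_sumr; congr (0 <= _).
apply: eq_bigr => x _; rewrite mulr_sumr; apply: eq_bigr => y _.
by rewrite entryZ; ring.
Qed.

Lemma psd0 X : psd (0 : op R X).
Proof.
apply/psdE => v; rewrite big1 // => x _; rewrite big1 // => y _.
by rewrite entry0; ring.
Qed.

Lemma psd_sum X (I : Type) (s : seq I) (P : pred I) (F : I -> op R X) :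
  (forall i, P i -> psd (F i)) -> psd (\sum_(i <- s | P i) F i).
Proof.
by move=> h; apply: (big_ind (@psd R X)) h; [exact: psd0|exact: psdD].
Qed.

Lemma psd_pure X (f : X -> R[i]) : psd (pure f).
Proof.
apply/psdE => v.
have -> : \sum_x \sum_y conj (v x) * entry (pure f) x y * v y =
    (\sum_x conj (v x) * f x) * conj (\sum_x conj (v x) * f x).
  rewrite rmorph_sum mulr_suml; apply: eq_bigr => x _.
  rewrite mulr_sumr; apply: eq_bigr => y _.
  by rewrite entry_pure rmorphM /= conjCK; ring.
exact: mul_conjC_ge0.
Qed.

Lemma psd_diag_ge0 X (a : op R X) x : psd a -> 0 <= entry a x x.
Proof.
move=> /psdE /(_ (fun t => (t == x)%:R)).
rewrite (bigD1 x) //= (bigD1 x) //= eqxx.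
rewrite big1 => [|t /negPf nz]; last by rewrite nz mulr0.
rewrite big1 => [|t /negPf nz]; last first.
  by rewrite big1 // => s _; rewrite nz rmorph0 !mul0r.
by rewrite rmorph1 !addr0 mul1r mulr1.
Qed.

(* Polarization: the values of the quadratic form at the vectors e_x, e_y,
   e_x + e_y and e_x + 'i e_y are real. *)
Lemma psd_herm X (a : op R X) : psd a -> forall x y, entry a y x = conj (entry a x y).
Proof.
move=> psd_a; move/psdE: (psd_a) => h x y.
have diag z : conj (entry a z z) = entry a z z.
  exact/CrealP/ger0_real/psd_diag_ge0.
have [->|nxy] := eqVneq x y; first by rewrite diag.
have key c d : \sum_z \sum_t conj ((z == x)%:R * c + (z == y)%:R * d) * entry a z t
      * ((t == x)%:R * c + (t == y)%:R * d) =
   conj c * c * entry a x x + conj d * d * entry a y y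
     + (conj c * d * entry a x y + conj d * c * entry a y x).
  have delta z (F : X -> R[i]) : \sum_t (t == z)%:R * F t = F z.
    rewrite (bigD1 z) //= eqxx mul1r big1 ?addr0 // => t /negPf ->.
    by rewrite mul0r.
  transitivity (\sum_z ((z == x)%:R * (conj c * (entry a z x * c + entry a z y * d))
     + (z == y)%:R * (conj d * (entry a z x * c + entry a z y * d)))).
    apply: eq_bigr => z _.
    pose e := conj ((z == x)%:R * c + (z == y)%:R * d).
    transitivity (\sum_t ((t == x)%:R * (e * (entry a z t * c))
       + (t == y)%:R * (e * (entry a z t * d)))).
      by apply: eq_bigr => t _; rewrite /e; ring.
    by rewrite big_split /= !delta /e !rmorphD !rmorphM /= !conjC_nat; ring.
  by rewrite big_split /= !delta; ring.
have := h (fun z => (z == x)%:R * 1 + (z == y)%:R * 1).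
rewrite key => /ger0_real/CrealP; rewrite !rmorphD !rmorphM /= !diag !conjCK !rmorph1 => e1.
have := h (fun z => (z == x)%:R * 1 + (z == y)%:R * 'i).
rewrite key => /ger0_real/CrealP.
rewrite !rmorphD !rmorphM /= !diag !conjCK !rmorph1 !conjCi => e2.
set u := entry a x y in e1 e2 *; set w := entry a y x in e1 e2 *.
have {}e1 : conj u + conj w = u + w by move: e1; rewrite !mul1r => /addrI.
have {}e2 : - conj u + conj w = u - w.
  apply: (mulfI (neq0Ci R[i])); apply: (addrI (entry a x x - 'i * 'i * entry a y y)).
  transitivity (1 * 1 * entry a x x + - 'i * 'i * entry a y y +
    (1 * 'i * u + - 'i * 1 * w)); last by ring.
  by rewrite -e2; ring.
have : 2 * w = 2 * conj u.
  transitivity ((u + w) - (u - w)); first ring.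
  by rewrite -e1 -e2; ring.
by move/mulfI; apply; rewrite pnatr_eq0.
Qed.

(** Spectral theorem: positivity forces Hermitian symmetry, so [a] is unitarily diagonalizable, and
    each eigenvector absorbs the square root of its eigenvalue. *)
Lemma psd_sum_pure X (a : op R X) : psd a ->
  exists w : 'I_#|X| -> X -> R[i], a = \sum_i pure (w i).
Proof.
move=> ha.
have /hermitian_normalmx/orthomx_spectralP E : a \is hermsymmx.
  apply/is_hermitianmxP; rewrite expr0 scale1r; apply: entry_ext => x y.
  by rewrite entry_adj -psd_herm.
pose P := spectralmx a; pose d := spectral_diag a.
have PU : P \is unitarymx := spectral_unitarymx a.
rewrite invmx_unitary // -/P -/d in E.
have aE x y : entry a x y =
    \sum_i conj (P i (enum_rank x)) * d 0 i * P i (enum_rank y).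
  rewrite {1}E /entry mxE; apply: eq_bigr => i _; rewrite mul_mx_diag !mxE.
  by rewrite mulrC.
(* The eigenvalue is the value of the quadratic form at its eigenvector, the conjugate of row [i] of
   [P]. *)
have d_ge0 i : 0 <= d 0 i.
  move/psdE: ha => /(_ (fun x => conj (P i (enum_rank x)))).
  have orth j k : \sum_x P j (enum_rank x) * conj (P k (enum_rank x)) = (j == k)%:R.
    move/unitarymxP/matrixP/(_ j k): PU; rewrite !mxE => <-.
    by rewrite big_ord_fin; apply: eq_bigr => x _; rewrite !mxE.
  suff -> : \sum_x \sum_y conj (conj (P i (enum_rank x))) * entry a x y *
      conj (P i (enum_rank y)) = d 0 i by [].
  transitivity (\sum_j d 0 j * (\sum_x P i (enum_rank x) * conj (P j (enum_rank x)))
      * (\sum_y P j (enum_rank y) * conj (P i (enum_rank y)))).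
    transitivity (\sum_x \sum_y \sum_j d 0 j * (P i (enum_rank x) * conj (P j (enum_rank x)))
      * (P j (enum_rank y) * conj (P i (enum_rank y)))).
      apply: eq_bigr => x _; apply: eq_bigr => y _; rewrite aE conjCK mulr_sumr mulr_suml.
      by apply: eq_bigr => j _; ring.
    under eq_bigr do rewrite exchange_big /=.
    rewrite exchange_big /=; apply: eq_bigr => j _.
    rewrite -mulrA big_distrlr /= mulr_sumr; apply: eq_bigr => x _.
    by rewrite mulr_sumr; apply: eq_bigr => y _; ring.
  rewrite (bigD1 i) //= !orth eqxx !mulr1 big1 ?addr0 // => j /negPf nj.
  by rewrite !orth nj mulr0.
exists (fun i x => sqrtC (d 0 i) * conj (P i (enum_rank x))).
apply: entry_ext => x y; rewrite aE entry_sum; apply: eq_bigr => i _.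
rewrite entry_pure rmorphM /= conjCK.
have /conj_Creal -> : sqrtC (d 0 i) \is Num.real by rewrite ger0_real ?sqrtC_ge0.
rewrite -{1}(sqrtCK (d 0 i)); ring.
Qed.

End Entries.

(** * Kraus decompositions *)

Section Kraus.
Variable R : realType.
Implicit Types X Y Z W : finType.
Local Notation conj := (@Num.conj R[i]).

Lemma sum_pair X Y (F : X * Y -> R[i]) : \sum_p F p = \sum_x \sum_y F (x, y).
Proof. by rewrite (pair_bigA _ (fun x y => F (x, y))); apply: eq_bigr => -[]. Qed.

Lemma sum_delta X (z : X) (F : X -> R[i]) : \sum_t (z == t)%:R * F t = F z.
Proof.
rewrite (bigD1 z) //= eqxx mul1r big1 ?addr0 // => t.
by rewrite eq_sym => /negPf ->; rewrite mul0r.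
Qed.

(** Conjugation of [rho] by one Kraus operator. [K] is a matrix written as a function of basis
    labels, output label first, so that products of systems need no index casts. *)
Definition kact X Y (K : Y -> X -> R[i]) (rho : op R X) : op R Y :=
  opmx (fun y y' => \sum_x \sum_x' K y x * entry rho x x' * conj (K y' x')).

Definition kid X (y x : X) : R[i] := (y == x)%:R.

Definition kcomp X Y Z (K : Z -> Y -> R[i]) (L : Y -> X -> R[i]) z x :=
  \sum_y K z y * L y x.

Definition ktens X Y X' Y' (K : Y -> X -> R[i]) (L : Y' -> X' -> R[i])
  (y : Y * Y') (x : X * X') := K y.1 x.1 * L y.2 x.2.

Lemma eq_kact X Y (K L : Y -> X -> R[i]) rho :
  (forall y x, K y x = L y x) -> kact K rho = kact L rho.
Proof.
move=> h; apply: eq_opmx => y y'; apply: eq_bigr => x _; apply: eq_bigr => x' _.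
by rewrite !h.
Qed.

Lemma kactD X Y (K : Y -> X -> R[i]) a b : kact K (a + b) = kact K a + kact K b.
Proof.
apply: entry_ext => y y'; rewrite entryD !entry_opmx -big_split /=.
apply: eq_bigr => x _; rewrite -big_split; apply: eq_bigr => x' _ /=.
by rewrite entryD mulrDr mulrDl.
Qed.

Lemma kactZ X Y (K : Y -> X -> R[i]) c a : kact K (c *: a) = c *: kact K a.
Proof.
apply: entry_ext => y y'; rewrite entryZ !entry_opmx mulr_sumr.
apply: eq_bigr => x _; rewrite mulr_sumr; apply: eq_bigr => x' _ /=.
by rewrite entryZ !mulrA (mulrC c).
Qed.

Lemma kact_comp X Y Z (K : Z -> Y -> R[i]) (L : Y -> X -> R[i]) rho :
  kact K (kact L rho) = kact (kcomp K L) rho.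
Proof.
apply: entry_ext => z z'; rewrite !entry_opmx.
transitivity (\sum_y \sum_y' \sum_x \sum_x'
   (K z y * L y x) * entry rho x x' * conj (K z' y' * L y' x')).
  apply: eq_bigr => y _; apply: eq_bigr => y' _; rewrite entry_opmx mulr_sumr mulr_suml.
  apply: eq_bigr => x _; rewrite mulr_sumr mulr_suml; apply: eq_bigr => x' _.
  by rewrite rmorphM; ring.
under eq_bigr do rewrite exchange_big /=.
rewrite exchange_big /=; apply: eq_bigr => x _.
under eq_bigr do rewrite exchange_big /=.
rewrite exchange_big /=; apply: eq_bigr => x' _.
rewrite /kcomp rmorph_sum mulr_suml mulr_suml; apply: eq_bigr => y _.
by rewrite mulr_sumr.
Qed.

Lemma kcomp_tens X Y Z X' Y' Z' (K : Z -> Y -> R[i]) (L : Y -> X -> R[i])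
    (K' : Z' -> Y' -> R[i]) (L' : Y' -> X' -> R[i]) z x :
  kcomp (ktens K K') (ktens L L') z x = ktens (kcomp K L) (kcomp K' L') z x.
Proof.
rewrite /kcomp /ktens sum_pair /= mulr_suml; apply: eq_bigr => y _.
by rewrite mulr_sumr; apply: eq_bigr => y' _; ring.
Qed.

Lemma kcompid X Y (K : Y -> X -> R[i]) y x : kcomp K (@kid X) y x = K y x.
Proof.
rewrite /kcomp /kid -[RHS](sum_delta x (fun t => K y t)).
by apply: eq_bigr => t _; rewrite mulrC eq_sym.
Qed.

Lemma kidcomp X Y (K : Y -> X -> R[i]) y x : kcomp (@kid Y) K y x = K y x.
Proof. by rewrite /kcomp /kid sum_delta. Qed.

Lemma kact_id X (rho : op R X) : kact (@kid X) rho = rho.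
Proof.
apply: entry_ext => x y; rewrite entry_opmx /kid -[RHS](sum_delta x (fun t => entry rho t y)).
apply: eq_bigr => t _; rewrite -[in RHS](sum_delta y (fun s => entry rho t s)) mulr_sumr.
by apply: eq_bigr => s _; rewrite conjC_nat; ring.
Qed.

Lemma psd_kact X Y (K : Y -> X -> R[i]) rho : psd rho -> psd (kact K rho).
Proof.
move=> /psdE h; apply/psdE => v.
have := h (fun x => \sum_y conj (K y x) * v y); congr (0 <= _).
transitivity (\sum_x \sum_x' \sum_y \sum_y'
  conj (v y) * (K y x * entry rho x x' * conj (K y' x')) * v y').
  apply: eq_bigr => x _; apply: eq_bigr => x' _.
  rewrite rmorph_sum mulr_suml mulr_suml; apply: eq_bigr => y _.
  by rewrite mulr_sumr; apply: eq_bigr => y' _; rewrite rmorphM /= conjCK; ring.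
under eq_bigr do rewrite exchange_big /=.
rewrite exchange_big /=; apply: eq_bigr => y _.
under eq_bigr do rewrite exchange_big /=.
rewrite exchange_big /=; apply: eq_bigr => y' _.
rewrite entry_opmx mulr_sumr mulr_suml; apply: eq_bigr => x _.
by rewrite mulr_sumr mulr_suml.
Qed.

Lemma kact_pure X Y (K : Y -> X -> R[i]) f :
  kact K (pure f) = pure (fun y => \sum_x K y x * f x).
Proof.
apply: entry_ext => y y'; rewrite entry_opmx entry_pure rmorph_sum mulr_suml.
apply: eq_bigr => x _; rewrite mulr_sumr; apply: eq_bigr => x' _.
by rewrite entry_pure rmorphM /=; ring.
Qed.

(** The operators form a list, so that adding two maps concatenates their decompositions. *)
Definition kraus X Y (F : op R X -> op R Y) :=
  exists s : seq (Y -> X -> R[i]), forall rho, F rho = \sum_(K <- s) kact K rho.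

Lemma kraus_kact X Y (K : Y -> X -> R[i]) : kraus (kact K).
Proof. by exists [:: K] => rho; rewrite big_seq1. Qed.

Lemma eq_kraus X Y (F G : op R X -> op R Y) : (forall rho, F rho = G rho) ->
  kraus G -> kraus F.
Proof. by move=> h [s hs]; exists s => rho; rewrite h. Qed.

Lemma krausD X Y (F G : op R X -> op R Y) : kraus F -> kraus G ->
  kraus (fun rho => F rho + G rho).
Proof. by move=> [s hs] [t ht]; exists (s ++ t) => rho; rewrite big_cat hs ht. Qed.

Lemma kraus_sum X Y I (r : seq I) (F : I -> op R X -> op R Y) :
  (forall i, kraus (F i)) -> kraus (fun rho => \sum_(i <- r) F i rho).
Proof.
move=> h; elim: r => [|i r ih]; first by exists [::] => rho; rewrite !big_nil.
by apply: eq_kraus (krausD (h i) ih) => rho; rewrite big_cons.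
Qed.

Lemma kraus_comp X Y Z (F : op R Y -> op R Z) (G : op R X -> op R Y) :
  kraus F -> kraus G -> kraus (fun rho => F (G rho)).
Proof.
move=> [s hs] [t ht].
apply: (@eq_kraus _ _ _ (fun rho => \sum_(K <- s) \sum_(L <- t) kact (kcomp K L) rho)).
  move=> rho; rewrite hs ht; apply: eq_bigr => K _.
  rewrite (big_morph _ (kactD K) (id1 := 0)); last first.
    by rewrite -(scale0r 0) kactZ scale0r.
  by apply: eq_bigr => L _; rewrite kact_comp.
by do 2!apply: kraus_sum => ?; exact: kraus_kact.
Qed.

Lemma kraus_linear X Y (F : op R X -> op R Y) : kraus F -> linear F.
Proof.
move=> [s hs] c a b; rewrite !hs scaler_sumr -big_split; apply: eq_bigr => K _.
by rewrite kactD kactZ.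
Qed.

Lemma linear_add X Y (F : op R X -> op R Y) : linear F ->
  forall a b, F (a + b) = F a + F b.
Proof. by move=> h a b; rewrite -[a in LHS]scale1r h scale1r. Qed.

Lemma linear_op0 X Y (F : op R X -> op R Y) : linear F -> F 0 = 0.
Proof. by move=> h; have := h (-1) 0 0; rewrite !scaleN1r !addNr. Qed.

Lemma linear_scale X Y (F : op R X -> op R Y) : linear F ->
  forall c a, F (c *: a) = c *: F a.
Proof. by move=> h c a; rewrite -[c *: a in LHS]addr0 h linear_op0 // addr0. Qed.

Lemma linear_scaleB X Y (F : op R X -> op R Y) : linear F ->
  forall c a b, F (c *: a - b) = c *: F a - F b.
Proof.
move=> h c a b; rewrite (linear_add h) (linear_scale h) -scaleN1r (linear_scale h).
by rewrite scaleN1r.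
Qed.

Lemma linear_opsum X Y (F : op R X -> op R Y) I (r : seq I) (P : pred I) G : linear F ->
  F (\sum_(i <- r | P i) G i) = \sum_(i <- r | P i) F (G i).
Proof. by move=> h; rewrite (big_morph F (linear_add h) (linear_op0 h)). Qed.

Lemma psd_kraus X Y (F : op R X -> op R Y) rho : kraus F -> psd rho -> psd (F rho).
Proof. by move=> [s ->] h; apply: psd_sum => K _; exact: psd_kact. Qed.

Lemma tens_id_kact X Y Z (K : Y -> X -> R[i]) (rho : op R (X * Z)%type) :
  tens_id (kact K) rho = kact (ktens K (@kid Z)) rho.
Proof.
apply: entry_ext => -[y z] [y' z']; rewrite !entry_opmx /= sum_pair.
apply: eq_bigr => x _; under [RHS]eq_bigr do rewrite sum_pair.
rewrite [RHS]exchange_big; apply: eq_bigr => x' _ /=.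
rewrite entry_opmx /ktens /kid /=.
rewrite -[LHS](sum_delta z (fun t => K y x * entry rho (x, t) (x', z') * conj (K y' x'))).
apply: eq_bigr => t _.
rewrite -[LHS](sum_delta z' (fun s =>
  (z == t)%:R * (K y x * entry rho (x, t) (x', s) * conj (K y' x')))).
by apply: eq_bigr => s _; rewrite rmorphM /= conjC_nat; ring.
Qed.

Lemma id_tens_kact X Y Z (K : Y -> X -> R[i]) (rho : op R (Z * X)%type) :
  id_tens (kact K) rho = kact (ktens (@kid Z) K) rho.
Proof.
apply: entry_ext => -[z y] [z' y']; rewrite !entry_opmx /=.
rewrite sum_pair [RHS]exchange_big; apply: eq_bigr => x _ /=.
under [RHS]eq_bigr do rewrite sum_pair exchange_big /=.
rewrite [RHS]exchange_big /=; apply: eq_bigr => x' _.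
rewrite entry_opmx /ktens /kid /=.
rewrite -[LHS](sum_delta z (fun t => K y x * entry rho (t, x) (z', x') * conj (K y' x'))).
apply: eq_bigr => t _.
rewrite -[LHS](sum_delta z' (fun s =>
  (z == t)%:R * (K y x * entry rho (t, x) (s, x') * conj (K y' x')))).
by apply: eq_bigr => s _; rewrite rmorphM /= conjC_nat; ring.
Qed.

Lemma tens_id_sum X Y Z I (r : seq I) (F : I -> op R X -> op R Y) (rho : op R (X * Z)%type) :
  tens_id (fun a => \sum_(i <- r) F i a) rho = \sum_(i <- r) tens_id (F i) rho.
Proof.
apply: entry_ext => y y'; rewrite entry_opmx !entry_sum.
by apply: eq_bigr => i _; rewrite entry_opmx.
Qed.

Lemma id_tens_sum X Y Z I (r : seq I) (F : I -> op R X -> op R Y) (rho : op R (Z * X)%type) :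
  id_tens (fun a => \sum_(i <- r) F i a) rho = \sum_(i <- r) id_tens (F i) rho.
Proof.
apply: entry_ext => y y'; rewrite entry_opmx !entry_sum.
by apply: eq_bigr => i _; rewrite entry_opmx.
Qed.

Lemma eq_tens_id X Y Z (F G : op R X -> op R Y) (rho : op R (X * Z)%type) :
  (forall a, F a = G a) -> tens_id F rho = tens_id G rho.
Proof. by move=> h; apply: eq_opmx => x y; rewrite h. Qed.

Lemma eq_id_tens X Y Z (F G : op R X -> op R Y) (rho : op R (Z * X)%type) :
  (forall a, F a = G a) -> id_tens F rho = id_tens G rho.
Proof. by move=> h; apply: eq_opmx => x y; rewrite h. Qed.

Lemma kraus_tens_id X Y Z (F : op R X -> op R Y) : kraus F ->
  kraus (@tens_id R X Y Z F).
Proof.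
move=> [s hs].
apply: (@eq_kraus _ _ _ (fun rho => \sum_(K <- s) kact (ktens K (@kid Z)) rho)).
  move=> rho; rewrite (eq_tens_id _ hs) tens_id_sum.
  by apply: eq_bigr => K _; rewrite tens_id_kact.
by apply: kraus_sum => K; exact: kraus_kact.
Qed.

Lemma kraus_id_tens X Y Z (F : op R X -> op R Y) : kraus F ->
  kraus (@id_tens R X Y Z F).
Proof.
move=> [s hs].
apply: (@eq_kraus _ _ _ (fun rho => \sum_(K <- s) kact (ktens (@kid Z) K) rho)).
  move=> rho; rewrite (eq_id_tens _ hs) id_tens_sum.
  by apply: eq_bigr => K _; rewrite id_tens_kact.
by apply: kraus_sum => K; exact: kraus_kact.
Qed.

Lemma kraus_cp X Y (F : op R X -> op R Y) : kraus F -> completely_positive F.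
Proof.
move=> h; split; first exact: kraus_linear.
by move=> Z rho; apply: psd_kraus; exact: kraus_tens_id.
Qed.

(* Choi: Kraus operators of F are read off a decomposition into pure terms of
   the image of the unnormalized maximally entangled operator on X * X. *)
Lemma cp_kraus X Y (F : op R X -> op R Y) : completely_positive F -> kraus F.
Proof.
move=> [lF hF].
have /psd_sum_pure [w hw] := hF X _ (@psd_pure R (X * X)%type (fun p => (p.1 == p.2)%:R)).
exists [seq (fun y x => w i (y, x)) | i <- index_enum _] => rho.
have decomp : rho = \sum_p entry rho p.1 p.2 *:
    opmx (fun x x' => (x == p.1)%:R * (x' == p.2)%:R).
  apply: entry_ext => x x'; rewrite entry_sum sum_pair.
  rewrite -[LHS](sum_delta x (fun t => entry rho t x')).
  apply: eq_bigr => t _; rewrite -(sum_delta x' (fun s => entry rho t s)) mulr_sumr.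
  by apply: eq_bigr => s _; rewrite entryZ entry_opmx /=; ring.
rewrite {1}decomp linear_opsum // big_map.
apply: entry_ext => y y'; rewrite !entry_sum.
under [RHS]eq_bigr do rewrite entry_opmx (pair_bigA _
  (fun x x' => w _ (y, x) * entry rho x x' * conj (w _ (y', x')))) /=.
rewrite exchange_big /=; apply: eq_bigr => -[x x'] _ /=.
rewrite linear_scale // entryZ.
have /(congr1 (fun a => entry a (y, x) (y', x'))) := hw.
rewrite entry_opmx entry_sum /=.
under eq_opmx do rewrite entry_pure /= conjC_nat.
move=> ->; rewrite mulr_sumr; apply: eq_bigr => i _; rewrite entry_pure; ring.
Qed.
End Kraus.

(** * Channels *)

Section Channels.
Variable R : realType.
Implicit Types X Y Z W : finType.
Local Notation conj := (@Num.conj R[i]).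

Definition trace_preserving X Y (F : op R X -> op R Y) := forall rho, \tr (F rho) = \tr rho.

Lemma channel_kraus X Y (F : op R X -> op R Y) : kraus F -> trace_preserving F -> channel F.
Proof. by move=> h t; split=> //; exact: kraus_cp. Qed.

Lemma tr_tens_id X Y Z (F : op R X -> op R Y) (rho : op R (X * Z)%type) :
  trace_preserving F -> \tr (tens_id F rho) = \tr rho.
Proof.
move=> h; rewrite !trE !sum_pair exchange_big [RHS]exchange_big /=.
apply: eq_bigr => z _.
transitivity (\tr (F (opmx (fun x x' => entry rho (x, z) (x', z))))).
  by rewrite trE; apply: eq_bigr => y _; rewrite entry_opmx.
by rewrite h trE; apply: eq_bigr => x _; rewrite entry_opmx.
Qed.

Lemma tr_id_tens X Y Z (F : op R X -> op R Y) (rho : op R (Z * X)%type) :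
  trace_preserving F -> \tr (id_tens F rho) = \tr rho.
Proof.
move=> h; rewrite !trE !sum_pair; apply: eq_bigr => z _ /=.
transitivity (\tr (F (opmx (fun x x' => entry rho (z, x) (z, x'))))).
  by rewrite trE; apply: eq_bigr => y _; rewrite entry_opmx.
by rewrite h trE; apply: eq_bigr => x _; rewrite entry_opmx.
Qed.

Lemma channel_tens_id X Y Z (F : op R X -> op R Y) : channel F -> channel (@tens_id R X Y Z F).
Proof.
move=> [h t]; apply: channel_kraus; first exact/kraus_tens_id/cp_kraus.
by move=> rho; exact: tr_tens_id.
Qed.

(** Here [f] sends new labels to old ones. For bijective [f] this is a channel; it serves to permute
    and reassociate tensor factors. *)
Definition relabel X Y (f : Y -> X) (rho : op R X) : op R Y :=
  opmx (fun y y' => entry rho (f y) (f y')).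

Lemma relabel_kact X Y (f : Y -> X) rho :
  relabel f rho = kact (fun y x => (f y == x)%:R) rho.
Proof.
apply: eq_opmx => y y'; rewrite -[LHS](sum_delta (f y) (fun t => entry rho t (f y'))).
apply: eq_bigr => t _; rewrite -[in LHS](sum_delta (f y') (fun s => entry rho t s)) mulr_sumr.
by apply: eq_bigr => s _; rewrite conjC_nat; ring.
Qed.

Lemma kraus_relabel X Y (f : Y -> X) : kraus (relabel f).
Proof. by apply: eq_kraus (kraus_kact _) => rho; exact: relabel_kact. Qed.

Lemma channel_relabel X Y (f : Y -> X) : bijective f -> channel (relabel f).
Proof.
move=> bf; apply: channel_kraus; first exact: kraus_relabel.
move=> rho; rewrite !trE [RHS](reindex f) /=; last exact: onW_bij.
by apply: eq_bigr => y _; rewrite entry_opmx.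
Qed.

Lemma ptrace_r_kact X Y (rho : op R (X * Y)%type) :
  ptrace_r rho = \sum_(y : Y) kact (fun x p => (x == p.1)%:R * (y == p.2)%:R) rho.
Proof.
apply: entry_ext => x x'; rewrite entry_opmx entry_sum; apply: eq_bigr => y _.
rewrite entry_opmx -[LHS](sum_delta (x, y) (fun t => entry rho t (x', y))).
apply: eq_bigr => -[t t'] _.
rewrite -[in LHS](sum_delta (x', y) (fun s => entry rho (t, t') s)) mulr_sumr.
apply: eq_bigr => -[s s'] _; rewrite rmorphM /= !conjC_nat !xpair_eqE.
by rewrite -!mulnb !natrM; ring.
Qed.

Lemma kraus_ptrace_r X Y : kraus (@ptrace_r R X Y).
Proof.
apply: (eq_kraus (@ptrace_r_kact X Y)).
by apply: kraus_sum => y; exact: kraus_kact.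
Qed.

Lemma tr_ptrace_r X Y (rho : op R (X * Y)%type) : \tr (ptrace_r rho) = \tr rho.
Proof. by rewrite !trE sum_pair; apply: eq_bigr => x _; rewrite entry_opmx. Qed.

Lemma ptrace_r_tens_id X Y Z (F : op R X -> op R Y) (rho : op R (X * Z)%type) :
  linear F -> ptrace_r (tens_id F rho) = F (ptrace_r rho).
Proof.
move=> h; have -> : ptrace_r rho = \sum_z opmx (fun x x' => entry rho (x, z) (x', z)).
  apply: entry_ext => x x'; rewrite entry_opmx entry_sum.
  by apply: eq_bigr => z _; rewrite entry_opmx.
rewrite linear_opsum //; apply: entry_ext => y y'; rewrite entry_opmx entry_sum.
by apply: eq_bigr => z _; rewrite entry_opmx.
Qed.

(** Local operations alone do not signal. In the converse bound this keeps the receiver's state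
    independent of the message. *)
Lemma ptrace_r_id_tens X Y Z (F : op R X -> op R Y) (rho : op R (Z * X)%type) :
  trace_preserving F -> ptrace_r (id_tens F rho) = ptrace_r rho.
Proof.
move=> h; apply: eq_opmx => z z'.
transitivity (\tr (F (opmx (fun x x' => entry rho (z, x) (z', x'))))).
  by rewrite trE; apply: eq_bigr => y _; rewrite entry_opmx.
by rewrite h trE; apply: eq_bigr => x _; rewrite entry_opmx.
Qed.

Lemma tr_mul_pure X (f : X -> R[i]) (a : op R X) :
  \tr (pure f *m a) = \sum_x \sum_y conj (f x) * entry a x y * f y.
Proof.
rewrite trE exchange_big /=; apply: eq_bigr => x _; rewrite entryM.
by apply: eq_bigr => y _; rewrite entry_pure; ring.
Qed.

Lemma psd_tr_mul_ge0 X (a b : op R X) : psd a -> psd b -> 0 <= \tr (a *m b).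
Proof.
move=> /psd_sum_pure[w ->] /psdE h; rewrite mulmx_suml raddf_sum sumr_ge0 // => i _ /=.
by rewrite tr_mul_pure.
Qed.

(** One branch of a measure-and-prepare map: the effect [P] occurs, and [E] is prepared. *)
Definition measure_prepare X Y (P : op R X) (E : op R Y) (rho : op R X) : op R Y :=
  \tr (P *m rho) *: E.

(** Decomposing both operators into pure terms gives the Kraus operators |e_j><p_i|. *)
Lemma kraus_measure_prepare X Y (P : op R X) (E : op R Y) : psd P -> psd E ->
  kraus (measure_prepare P E).
Proof.
move=> /psd_sum_pure[p hp] /psd_sum_pure[e he].
apply: (@eq_kraus _ _ _ _ (fun rho => \sum_i \sum_j
   kact (fun y x => e j y * conj (p i x)) rho)); last first.
  by do 2!apply: kraus_sum => ?; exact: kraus_kact.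
move=> rho; rewrite /measure_prepare hp mulmx_suml raddf_sum scaler_suml.
apply: eq_bigr => i _; rewrite he scaler_sumr; apply: eq_bigr => j _ /=.
rewrite tr_mul_pure; apply: entry_ext => y y'; rewrite entryZ entry_pure entry_opmx mulr_suml.
apply: eq_bigr => x _; rewrite mulr_suml; apply: eq_bigr => x' _.
by rewrite rmorphM /= conjCK; ring.
Qed.

(** Up to regrouping of factors, a use of the box is [N] tensored with the identity on both
    memories, so it inherits a Kraus form from [N]. *)
Lemma use_boxE (S C S' X Y : finType) (N : op R (S * C)%type -> op R S')
    (rho : op R ((S * X) * (C * Y))%type) :
  use_box N rho = relabel (fun p => (p.1.1, (p.1.2, p.2)))
    (tens_id N (relabel (fun q => ((q.1.1, q.2.1), (q.1.2, q.2.2))) rho)).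
Proof.
apply: eq_opmx => -[[s x] y] [[s' x'] y']; rewrite entry_opmx /=.
by congr (entry (N _) _ _); apply: eq_opmx => -[t c] [t' c']; rewrite entry_opmx.
Qed.

Lemma kraus_use_box (S C S' X Y : finType) (N : op R (S * C)%type -> op R S') : kraus N ->
  kraus (@use_box R S C S' X Y N).
Proof.
move=> h; apply: eq_kraus (@use_boxE _ _ _ _ _ N) _.
apply: (kraus_comp (kraus_relabel _)); apply: kraus_comp (kraus_relabel _).
exact: kraus_tens_id.
Qed.

Lemma mulmx_kact X (a b : op R X) : a *m b *m a^t* = kact (entry a) b.
Proof.
apply: entry_ext => x y; rewrite entryM entry_opmx [RHS]exchange_big /=.
apply: eq_bigr => z _; rewrite entryM mulr_suml entry_adj.
by apply: eq_bigr => t _.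
Qed.

Lemma psd1 X : psd (1%:M : op R X).
Proof.
apply/psdE => v; apply: sumr_ge0 => x _; apply: sumr_ge0 => y _; rewrite entry1.
have [->|_] := eqVneq x y; last by rewrite mulr0 mul0r.
by rewrite mulr1 mulrC mul_conjC_ge0.
Qed.

Lemma pure_mul_pure X (f : X -> R[i]) :
  pure f *m pure f = \tr (pure f) *: pure f.
Proof.
apply: entry_ext => x y; rewrite entryM entryZ entry_pure trE mulr_suml.
by apply: eq_bigr => z _; rewrite !entry_pure; ring.
Qed.

(** For a unit vector the complement is an orthogonal projector, hence the product of itself with
    its adjoint. *)
Lemma psd_pure_compl X (f : X -> R[i]) : \tr (pure f) = 1 -> psd (1%:M - pure f).
Proof.
move=> t; have e := pure_mul_pure f; rewrite t scale1r in e.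
have h : (1%:M - pure f)^t* = 1%:M - pure f.
  apply: entry_ext => x x'; rewrite entry_adj !entryD !entryN !entry1 !entry_pure.
  by rewrite rmorphB rmorphM /= conjC_nat conjCK eq_sym; ring.
suff -> : 1%:M - pure f = (1%:M - pure f) *m 1%:M *m (1%:M - pure f)^t*.
  by rewrite mulmx_kact; apply/psd_kact/psd1.
by rewrite h mulmx1 mulmxBl !mulmxBr !mulmx1 mul1mx e subrr subr0.
Qed.
End Channels.

(** * The isotropic twirl *)

Section Isotropic.
Variable R : realType.
Local Notation conj := (@Num.conj R[i]).

Definition q0 : qubit := @Ordinal 2 0 isT.
Definition q1 : qubit := @Ordinal 2 1 isT.

Lemma qubitP (P : qubit -> Prop) : P q0 -> P q1 -> forall a, P a.
Proof.
move=> h0 h1 [[|[|//]] h]; first by have -> : Ordinal h = q0 by apply: val_inj.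
by have -> : Ordinal h = q1 by apply: val_inj.
Qed.

Lemma sum_qubit (F : qubit -> R[i]) : \sum_a F a = F q0 + F q1.
Proof.
by rewrite big_ord_recl big_ord1; congr (F _ + F _); apply: val_inj.
Qed.

Lemma conj_inv_sqrt2 : conj (inv_sqrt2 R) = inv_sqrt2 R.
Proof. exact: conjc_real. Qed.

Lemma inv_sqrt2M : inv_sqrt2 R * inv_sqrt2 R = 2^-1.
Proof.
rewrite /inv_sqrt2 -rmorphM /= -invfM -expr2 sqr_sqrtr ?ler0n //.
by rewrite fmorphV /= rmorph_nat.
Qed.

Lemma entry_epr (x y : qubit * qubit) : entry (epr R) x y =
  (x.1 == x.2)%:R * (y.1 == y.2)%:R / 2.
Proof.
by rewrite entry_pure /epr_amp; case: (x.1 == x.2); case: (y.1 == y.2);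
  rewrite /= ?rmorph0 ?mulr0 ?mul0r // conj_inv_sqrt2 inv_sqrt2M /=; field.
Qed.

Lemma tr_epr : \tr (epr R) = 1.
Proof. by rewrite trE sum_pair !sum_qubit !entry_epr /=; field. Qed.

Lemma tr_epr_mul (s : op R (qubit * qubit)%type) : \tr (epr R *m s) =
  (entry s (q0, q0) (q0, q0) + entry s (q0, q0) (q1, q1) +
   entry s (q1, q1) (q0, q0) + entry s (q1, q1) (q1, q1)) / 2.
Proof.
by rewrite trE sum_pair !sum_qubit !entryM !sum_pair !sum_qubit !entry_epr /=; field.
Qed.

(** The state E1, uniform on the 3-dimensional orthogonal complement of Psi+. *)
Definition epr_compl : op R (qubit * qubit)%type := 3^-1 *: (1%:M - epr R).

Definition isotropic (s : op R (qubit * qubit)%type) : op R (qubit * qubit)%type :=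
  \tr (epr R *m s) *: epr R + (\tr s - \tr (epr R *m s)) *: epr_compl.

Lemma epr_idem : epr R *m epr R = epr R.
Proof. by rewrite pure_mul_pure -/(epr R) tr_epr scale1r. Qed.

Lemma tr_epr_compl : \tr epr_compl = 1.
Proof.
by rewrite mxtraceZ raddfB /= tr_epr trE sum_pair !sum_qubit !entry1 !eqxx /=; field.
Qed.

Lemma tr_epr_epr_compl : \tr (epr R *m epr_compl) = 0.
Proof. by rewrite -scalemxAr mulmxBr mulmx1 epr_idem subrr scaler0 mxtrace0. Qed.

Lemma psd_epr : psd (epr R). Proof. exact: psd_pure. Qed.

Lemma psd_epr_compl : psd epr_compl.
Proof.
apply: psdZ; first by rewrite invr_ge0 ler0n.
by apply: psd_pure_compl; exact: tr_epr.
Qed.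

Lemma tr_isotropic s : \tr (isotropic s) = \tr s.
Proof.
rewrite mxtraceD (mxtraceZ _ (epr R)) (mxtraceZ _ epr_compl) tr_epr tr_epr_compl.
by ring.
Qed.

Lemma epr_isotropic s : \tr (epr R *m isotropic s) = \tr (epr R *m s).
Proof.
rewrite mulmxDr -(scalemxAr _ _ (epr R)) -(scalemxAr _ _ epr_compl) mxtraceD.
rewrite (mxtraceZ _ (_ *m epr R)) (mxtraceZ _ (_ *m epr_compl)).
rewrite epr_idem tr_epr tr_epr_epr_compl.
by ring.
Qed.

Lemma entry_isotropic s x y : entry (isotropic s) x y =
  \tr (epr R *m s) * entry (epr R) x y +
  (\tr s - \tr (epr R *m s)) / 3 * ((x == y)%:R - entry (epr R) x y).
Proof. by rewrite entryD !entryZ entryD entryN entry1 mulrA. Qed.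

Definition Ubar_act (U : qubit -> qubit -> R[i]) :=
  kact (ktens U (fun a b => conj (U a b))).

(** The power Z^j, so that a uniform average over [bool] is a twirl; likewise X^j below. *)
Definition pauliZ (j : bool) (a b : qubit) : R[i] :=
  if a == b then (-1) ^+ (j && (a == q1)) else 0.

Definition pauliX (j : bool) (a b : qubit) : R[i] := ((a == b) != j)%:R.

(* S H, which permutes the Pauli matrices X, Y, Z cyclically under conjugation. *)
Definition cliff3 (a b : qubit) : R[i] :=
  inv_sqrt2 R * (if a == q0 then 1 else (-1) ^+ (b == q1) * 'i).

(** The cube of [cliff3] is a scalar, so its square is its adjoint up to a phase, and the phase
    cancels under conjugation. *)
Definition cliff3_pow (j : 'I_3) : qubit -> qubit -> R[i] :=
  match val j with 0 => @kid R qubit | 1 => cliff3 | _ => fun a b => conj (cliff3 b a) end.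

Definition mix (J : finType) (U : J -> qubit -> qubit -> R[i]) s :=
  #|J|%:R^-1 *: \sum_j Ubar_act (U j) s.

Lemma entry_Ubar_act U s a b c d : entry (Ubar_act U s) (a, b) (c, d) =
  \sum_x \sum_y \sum_z \sum_t (U a x * conj (U b y)) * entry s (x, y) (z, t)
     * (conj (U c z) * U d t).
Proof.
rewrite entry_opmx sum_pair; apply: eq_bigr => x _; apply: eq_bigr => y _.
rewrite sum_pair; apply: eq_bigr => z _; apply: eq_bigr => t _.
by rewrite /ktens rmorphM /= conjCK.
Qed.

(** Z (x) Z multiplies a basis vector by the sign of its parity, so the average removes the
    coherences between the two parity sectors. *)
Lemma mix_pauliZ s : mix pauliZ s =
  opmx (fun x y => ((x.1 == x.2) == (y.1 == y.2))%:R * entry s x y).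
Proof.
apply: entry_ext => -[a b] [c d].
rewrite entryZ entry_sum card_bool big_bool !entry_Ubar_act entry_opmx /=.
rewrite !sum_qubit /pauliZ.
elim/qubitP: a; elim/qubitP: b; elim/qubitP: c; elim/qubitP: d;
  by rewrite /= ?rmorph0 ?rmorphN ?rmorph1; field.
Qed.

(** The operators diagonal in the Bell basis: weights p + q, p - q on the even parity sector and r +
    t, r - t on the odd one. *)
Definition bell_diag (p q r t : R[i]) : op R (qubit * qubit)%type :=
  opmx (fun x y => if x.1 == x.2
    then (if y.1 == y.2 then (if x.1 == y.1 then p else q) else 0)
    else (if y.1 == y.2 then 0 else (if x.1 == y.1 then r else t))).

Lemma mix_pauliXZ s : mix pauliX (mix pauliZ s) = bell_diag
  ((entry s (q0, q0) (q0, q0) + entry s (q1, q1) (q1, q1)) / 2)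
  ((entry s (q0, q0) (q1, q1) + entry s (q1, q1) (q0, q0)) / 2)
  ((entry s (q0, q1) (q0, q1) + entry s (q1, q0) (q1, q0)) / 2)
  ((entry s (q0, q1) (q1, q0) + entry s (q1, q0) (q0, q1)) / 2).
Proof.
rewrite mix_pauliZ; set s' := opmx _.
apply: entry_ext => -[a b] [c d].
rewrite entryZ entry_sum card_bool big_bool !entry_Ubar_act entry_opmx /=.
rewrite !sum_qubit /pauliX !entry_opmx /=.
elim/qubitP: a; elim/qubitP: b; elim/qubitP: c; elim/qubitP: d;
  by rewrite /= ?rmorph0 ?rmorph1; field.
Qed.

(** The Clifford unitary fixes Psi+ and permutes the other three Bell states cyclically up to
    phases, so the average equalizes their weights. This is checked entry by entry. *)
Lemma mix_cliff3 p q r t :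
  mix cliff3_pow (bell_diag p q r t) = isotropic (bell_diag p q r t).
Proof.
apply: entry_ext => -[a b] [c d]; rewrite entry_isotropic entry_epr tr_epr_mul trE sum_pair.
rewrite !sum_qubit !entry_opmx /=.
rewrite entryZ entry_sum card_ord !big_ord_recl big_ord0 !entry_Ubar_act /cliff3_pow /=.
have i2 : ('i : R[i]) * 'i = -1 by rewrite -expr2 sqrCi.
have h2 : inv_sqrt2 R * inv_sqrt2 R = 2^-1 := inv_sqrt2M.
rewrite !sum_qubit !entry_opmx /= !(mulr0, mul0r, addr0, add0r) /cliff3 /kid.
set h := inv_sqrt2 R in h2 *.
have hM u v : h * u * (h * v) = 2^-1 * (u * v) by rewrite mulrACA h2.
elim/qubitP: a; elim/qubitP: b; elim/qubitP: c; elim/qubitP: d;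
  rewrite /= ?expr0 ?expr1 ?rmorph0 ?rmorph1 ?rmorphM /= ?conj_inv_sqrt2 ?conjCK
    ?(rmorphM, rmorphN, rmorph1) /= ?conjCi -/h ?hM ?mulr0 ?mul0r ?addr0 ?add0r;
  by field: i2.
Qed.
End Isotropic.

(** * LOCC maps *)

Section Locc.
Variable R : realType.
Local Notation conj := (@Num.conj R[i]).

Lemma actAE (A B C A' : finType) (F : op R A -> op R A') (rho : op R (A * B * C)%type) :
  actA F rho = tens_id (@tens_id R A A' B F) rho.
Proof.
apply: entry_ext => -[[a b] c] [[a' b'] c']; rewrite !entry_opmx /=.
by congr (entry (F _) _ _); apply: eq_opmx => x x'; rewrite entry_opmx.
Qed.

Lemma actBE (A B C B' : finType) (F : op R B -> op R B') (rho : op R (A * B * C)%type) :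
  actB F rho = tens_id (@id_tens R B B' A F) rho.
Proof.
apply: entry_ext => -[[a b] c] [[a' b'] c']; rewrite !entry_opmx /=.
by congr (entry (F _) _ _); apply: eq_opmx => x x'; rewrite entry_opmx.
Qed.

Lemma actCE (A B C C' : finType) (F : op R C -> op R C') (rho : op R (A * B * C)%type) :
  actC F rho = id_tens F rho.
Proof. by apply: entry_ext => -[[a b] c] [[a' b'] c']; rewrite !entry_opmx. Qed.

Lemma tens_id_comp (X Y Z W : finType) (F : op R Y -> op R Z) (G : op R X -> op R Y)
    (rho : op R (X * W)%type) :
  tens_id F (tens_id G rho) = tens_id (fun a => F (G a)) rho.
Proof.
apply: eq_opmx => z z' /=; congr (entry (F _) _ _); rewrite -[RHS]opmxK.
by apply: eq_opmx => y y'; rewrite entry_opmx.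
Qed.

(** Induction on the first protocol: linearity moves [G] inside the sums over outcomes, down to the
    leaves, where the protocol of [G] takes over. *)
Lemma locc_post (A B C A1 B1 C1 A2 B2 C2 : finType)
    (L : op R (A * B * C)%type -> op R (A1 * B1 * C1)%type)
    (G : op R (A1 * B1 * C1)%type -> op R (A2 * B2 * C2)%type) :
  locc L -> locc G -> linear G -> locc (fun rho => G (L rho)).
Proof.
move=> hL hG lG; elim: hL => {A B C L}.
- exact: hG.
- move=> A B C I A3 F next hF _ ih.
  rewrite (_ : (fun rho => _) = fun rho => \sum_i G (next i (actA (F i) rho))).
    exact: (@locc_A _ _ _ _ A B C I A3 F (fun i rho => G (next i rho))).
  by apply: funext => rho; rewrite linear_opsum.
- move=> A B C I A3 F next hF _ ih.
  rewrite (_ : (fun rho => _) = fun rho => \sum_i G (next i (actB (F i) rho))).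
    exact: (@locc_B _ _ _ _ A B C I A3 F (fun i rho => G (next i rho))).
  by apply: funext => rho; rewrite linear_opsum.
- move=> A B C I A3 F next hF _ ih.
  rewrite (_ : (fun rho => _) = fun rho => \sum_i G (next i (actC (F i) rho))).
    exact: (@locc_C _ _ _ _ A B C I A3 F (fun i rho => G (next i rho))).
  by apply: funext => rho; rewrite linear_opsum.
Qed.

Definition isometric (X Y : finType) (K : Y -> X -> R[i]) :=
  forall x x', \sum_y conj (K y x') * K y x = (x == x')%:R.

Lemma tr_kact_isometric (X Y : finType) (K : Y -> X -> R[i]) : isometric K ->
  trace_preserving (kact K).
Proof.
move=> h rho; rewrite !trE.
transitivity (\sum_x \sum_x' entry rho x x' * \sum_y conj (K y x') * K y x).
  under eq_bigr do rewrite entry_opmx.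
  rewrite exchange_big; apply: eq_bigr => x _ /=; rewrite exchange_big.
  apply: eq_bigr => x' _ /=; rewrite mulr_sumr; apply: eq_bigr => y _; ring.
apply: eq_bigr => x _; rewrite -[RHS](sum_delta x (fun t => entry rho x t)).
by apply: eq_bigr => x' _; rewrite h mulrC.
Qed.

Lemma scale_cp (X Y : finType) c (F : op R X -> op R Y) : 0 <= c ->
  completely_positive F -> completely_positive (fun rho => c *: F rho).
Proof.
move=> hc [lF pF]; split=> [d a b|Z rho hrho].
  by rewrite lF scalerDr !scalerA mulrC.
rewrite (_ : tens_id _ rho = c *: tens_id F rho); first exact: psdZ (pF _ _ hrho).
by apply: entry_ext => x y; rewrite entryZ !entry_opmx entryZ.
Qed.

Lemma cp_kact (X Y : finType) (K : Y -> X -> R[i]) : completely_positive (kact K).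
Proof. exact/kraus_cp/kraus_kact. Qed.


Lemma linear_mix (J : finType) (U : J -> qubit -> qubit -> R[i]) : linear (mix U).
Proof.
move=> c a b; rewrite /mix !scaler_sumr -big_split; apply: eq_bigr => j _ /=.
by rewrite /Ubar_act kactD kactZ scalerDr !scalerA mulrC.
Qed.

Lemma linear_tens_id (X Y Z : finType) (F : op R X -> op R Y) : linear F ->
  linear (@tens_id R X Y Z F).
Proof.
move=> lF c a b; apply: entry_ext => y y'; rewrite entryD entryZ !entry_opmx.
rewrite -entryZ -entryD -lF; congr (entry (F _) _ _).
by apply: entry_ext => x x'; rewrite entryD entryZ !entry_opmx entryD entryZ.
Qed.

(** Alice draws [j] uniformly, as the outcome of an instrument that also applies [U j], and
    broadcasts it; Bob then applies the conjugate of [U j]. *)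
Lemma locc_mix (J C : finType) (U : J -> qubit -> qubit -> R[i]) : (0 < #|J|)%N ->
  (forall j, isometric (U j)) -> locc (@tens_id R _ _ C (mix U)).
Proof.
move=> J0 hU.
pose Ubar j := kact (fun a b => conj (U j a b)).
have hUbar j : isometric (fun a b => conj (U j a b)).
  move=> x x'; rewrite eq_sym -(hU j); apply: eq_bigr => y _.
  by rewrite conjCK mulrC.
(* Bob's deterministic channel is an instrument with outcomes in [unit], hence the one-term inner
   sum. *)
rewrite (_ : tens_id _ = fun rho : op R (qubit * qubit * C)%type =>
   \sum_j (fun s => \sum_(i : unit) id (actB (Ubar j) s))
     (actA (fun s => #|J|%:R^-1 *: kact (U j) s) rho)).
  refine (@locc_A R qubit qubit C qubit qubit C J (fun=> qubit)
    (fun j s => #|J|%:R^-1 *: kact (U j) s)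
    (fun j s => \sum_(i : unit) id (actB (Ubar j) s)) _ _).
    split=> [j|rho]; first by apply: scale_cp (cp_kact _); rewrite invr_ge0 ler0n.
    under eq_bigr do rewrite mxtraceZ tr_kact_isometric //.
    rewrite sumr_const -[_ *+ _]mulr_natl mulrA divff ?mul1r //.
    by rewrite pnatr_eq0 -lt0n.
  move=> j; refine (@locc_B R qubit qubit C qubit qubit C unit (fun=> qubit)
    (fun=> Ubar j) (fun=> id) _ _).
    split=> [i|rho]; first exact: cp_kact.
    by rewrite (big_pred1 tt) => [|[]//]; apply: tr_kact_isometric.
  by move=> i; exact: locc_done.
apply: funext => rho; apply: entry_ext => x y; rewrite !entry_opmx /mix.
rewrite scaler_sumr !entry_sum; apply: eq_bigr => j _.
rewrite (big_pred1 tt) => [|[]//]; rewrite actBE actAE tens_id_comp entry_opmx.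
congr entry; rewrite /Ubar id_tens_kact.
rewrite (_ : tens_id _ _ = #|J|%:R^-1 *: kact (ktens (U j) (@kid R _))
    (opmx (fun u u' => entry rho (u, x.2) (u', y.2)))).
  rewrite kactZ kact_comp; congr (_ *: _); apply: eq_kact => u v.
  rewrite kcomp_tens /ktens kidcomp kcompid //.
rewrite -tens_id_kact; apply: entry_ext => u v; rewrite [LHS]entry_opmx !entryZ.
by congr (_ * _); rewrite [RHS]entry_opmx.
Qed.

Lemma isometric_pauliZ j : isometric (@pauliZ R j).
Proof.
move=> x x'; rewrite sum_qubit /pauliZ.
by elim/qubitP: x; elim/qubitP: x'; case: j;
  rewrite /= ?rmorph0 ?rmorphN ?rmorph1 ?expr0 ?expr1 ?rmorphN ?rmorph1 /=; ring.
Qed.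

Lemma isometric_pauliX j : isometric (@pauliX R j).
Proof.
move=> x x'; rewrite sum_qubit /pauliX.
by elim/qubitP: x; elim/qubitP: x'; case: j;
  rewrite /= ?rmorph0 ?rmorph1 /=; ring.
Qed.

Lemma isometric_cliff3 j : isometric (@cliff3_pow R j).
Proof.
have i2 : ('i : R[i]) * 'i = -1 by rewrite -expr2 sqrCi.
have hM u v : inv_sqrt2 R * u * (inv_sqrt2 R * v) = 2^-1 * (u * v).
  by rewrite mulrACA inv_sqrt2M.
move=> x x'; rewrite sum_qubit /cliff3_pow; case: j => -[|[|[|//]]] hj;
elim/qubitP: x; elim/qubitP: x'; rewrite /= /kid /cliff3 /=
   ?expr0 ?expr1 ?rmorph0 ?rmorph1 ?rmorphM /= ?conj_inv_sqrt2 ?conjCK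
    ?(rmorphM, rmorphN, rmorph1) /= ?conjCi ?hM; by field: i2.
Qed.

(** Making [s] Bell-diagonal changes neither its trace nor its overlap with Psi+, and these two
    numbers determine [isotropic]. *)
Lemma isotropic_mix s :
  mix (@cliff3_pow R) (mix (@pauliX R) (mix (@pauliZ R) s)) = isotropic s.
Proof.
rewrite mix_pauliXZ mix_cliff3; set b := bell_diag _ _ _ _.
have e1 : \tr b = \tr s.
  by rewrite !trE !sum_pair !sum_qubit !entry_opmx /=; field.
have e2 : \tr (epr R *m b) = \tr (epr R *m s).
  by rewrite !tr_epr_mul !entry_opmx /=; field.
by rewrite /isotropic e1 e2.
Qed.

Lemma linear_isotropic : linear (@isotropic R).
Proof. by move=> c a b; rewrite -!isotropic_mix !linear_mix. Qed.

Lemma locc_isotropic (A B C C' : finType)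
    (L : op R (A * B * C)%type -> op R (qubit * qubit * C')%type) :
  locc L -> locc (fun rho => tens_id (@isotropic R) (L rho)).
Proof.
move=> hL.
rewrite (_ : (fun _ => _) = fun rho => tens_id (mix (@cliff3_pow R))
    (tens_id (mix (@pauliX R)) (tens_id (mix (@pauliZ R)) (L rho)))); last first.
  by apply: funext => rho; rewrite !tens_id_comp; apply: eq_tens_id => a;
     rewrite isotropic_mix.
apply: locc_post (linear_tens_id (@linear_mix _ _)).
  apply: locc_post (linear_tens_id (@linear_mix _ _)).
    apply: locc_post (linear_tens_id (@linear_mix _ _)) => //.
    by apply: locc_mix isometric_pauliZ; rewrite card_bool.
  by apply: locc_mix isometric_pauliX; rewrite card_bool.
by apply: locc_mix isometric_cliff3; rewrite card_ord.
Qed.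

(** * Separable form of LOCC maps: Kraus operators that are products A (x) B (x) C *)

Definition separable (A B C A' B' C' : finType)
    (L : op R (A * B * C)%type -> op R (A' * B' * C')%type) :=
  exists s : seq ((A' -> A -> R[i]) * (B' -> B -> R[i]) * (C' -> C -> R[i])),
    forall rho, L rho = \sum_(k <- s) kact (ktens (ktens k.1.1 k.1.2) k.2) rho.

Lemma separable_sum (A B C A' B' C' I : finType)
    (L : I -> op R (A * B * C)%type -> op R (A' * B' * C')%type) :
  (forall i, separable (L i)) -> separable (fun rho => \sum_i L i rho).
Proof.
move=> h; elim: (index_enum I) => [|i r [t ht]]; first by exists [::] => rho; rewrite !big_nil.
by have [s hs] := h i; exists (s ++ t) => rho; rewrite big_cons big_cat /= hs ht.
Qed.

Lemma separable_comp (A B C A1 B1 C1 A2 B2 C2 : finType)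
    (G : op R (A1 * B1 * C1)%type -> op R (A2 * B2 * C2)%type)
    (L : op R (A * B * C)%type -> op R (A1 * B1 * C1)%type) :
  separable G -> separable L -> separable (fun rho => G (L rho)).
Proof.
move=> [s hs] [t ht].
exists [seq (kcomp k.1.1 l.1.1, kcomp k.1.2 l.1.2, kcomp k.2 l.2) | k <- s, l <- t] => rho.
rewrite big_allpairs_dep hs ht; apply: eq_bigr => k _ /=.
rewrite (linear_opsum _ _ _ (kraus_linear (kraus_kact _))); apply: eq_bigr => l _.
rewrite kact_comp; apply: eq_kact => y x.
by rewrite kcomp_tens /ktens -/(ktens _ _) kcomp_tens.
Qed.

Lemma separable_actA (A B C A' : finType) (F : op R A -> op R A') :
  completely_positive F -> separable (@actA R A B C A' F).
Proof.
move=> /cp_kraus[s hs]; exists [seq (K, @kid R B, @kid R C) | K <- s] => rho.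
rewrite big_map actAE (eq_tens_id _ (fun a => eq_tens_id a hs)).
rewrite (eq_tens_id _ (fun a => tens_id_sum _ _ a)) tens_id_sum; apply: eq_bigr => K _ /=.
by rewrite (eq_tens_id _ (fun a => tens_id_kact _ a)) tens_id_kact.
Qed.

Lemma separable_actB (A B C B' : finType) (F : op R B -> op R B') :
  completely_positive F -> separable (@actB R A B C B' F).
Proof.
move=> /cp_kraus[s hs]; exists [seq (@kid R A, K, @kid R C) | K <- s] => rho.
rewrite big_map actBE (eq_tens_id _ (fun a => eq_id_tens a hs)).
rewrite (eq_tens_id _ (fun a => id_tens_sum _ _ a)) tens_id_sum; apply: eq_bigr => K _ /=.
by rewrite (eq_tens_id _ (fun a => id_tens_kact _ a)) tens_id_kact.
Qed.

Lemma separable_actC (A B C C' : finType) (F : op R C -> op R C') :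
  completely_positive F -> separable (@actC R A B C C' F).
Proof.
move=> /cp_kraus[s hs]; exists [seq (@kid R A, @kid R B, K) | K <- s] => rho.
rewrite big_map actCE (eq_id_tens _ hs) id_tens_sum; apply: eq_bigr => K _ /=.
rewrite id_tens_kact; apply: eq_kact => -[[a b] c] [[x y] z].
by rewrite /ktens /kid /= xpair_eqE -mulnb natrM.
Qed.

Lemma instrument_tr (X I : finType) (Y : I -> finType)
    (F : forall i, op R X -> op R (Y i)) (W : finType) (rho : op R (X * W)%type) :
  instrument F -> \sum_i \tr (tens_id (F i) rho) = \tr rho.
Proof.
move=> [_ h]; rewrite trE sum_pair exchange_big.
transitivity (\sum_w \sum_i \tr (F i (opmx (fun x x' => entry rho (x, w) (x', w))))).
  rewrite exchange_big; apply: eq_bigr => i _ /=; rewrite trE sum_pair exchange_big.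
  by apply: eq_bigr => w _; rewrite trE; apply: eq_bigr => y _; rewrite entry_opmx.
apply: eq_bigr => w _; rewrite h trE; apply: eq_bigr => x _; by rewrite entry_opmx.
Qed.

Lemma instrument_tr_r (X I : finType) (Y : I -> finType)
    (F : forall i, op R X -> op R (Y i)) (W : finType) (rho : op R (W * X)%type) :
  instrument F -> \sum_i \tr (id_tens (F i) rho) = \tr rho.
Proof.
move=> [_ h]; rewrite trE sum_pair.
transitivity (\sum_w \sum_i \tr (F i (opmx (fun x x' => entry rho (w, x) (w, x'))))).
  rewrite exchange_big; apply: eq_bigr => i _ /=; rewrite trE sum_pair.
  by apply: eq_bigr => w _; rewrite trE; apply: eq_bigr => y _; rewrite entry_opmx.
apply: eq_bigr => w _; rewrite h trE; apply: eq_bigr => x _; by rewrite entry_opmx.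
Qed.

Lemma instrument_tens_id (X I : finType) (Y : I -> finType)
    (F : forall i, op R X -> op R (Y i)) (W : finType) :
  instrument F -> instrument (fun i => @tens_id R X (Y i) W (F i)).
Proof.
move=> h; split=> [i|rho]; last exact: instrument_tr.
by apply/kraus_cp/kraus_tens_id/cp_kraus; case: h.
Qed.

Lemma instrument_id_tens (X I : finType) (Y : I -> finType)
    (F : forall i, op R X -> op R (Y i)) (W : finType) :
  instrument F -> instrument (fun i => @id_tens R X (Y i) W (F i)).
Proof.
move=> h; split=> [i|rho]; last exact: instrument_tr_r.
by apply/kraus_cp/kraus_id_tens/cp_kraus; case: h.
Qed.

(** Induction on the protocol: a local instrument has Kraus operators that are the identity on the
    other two parties, composition preserves products, and averaging over the broadcast outcome only
    concatenates lists. *)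
Lemma locc_separable (A B C A' B' C' : finType)
    (L : op R (A * B * C)%type -> op R (A' * B' * C')%type) :
  locc L -> separable L /\ trace_preserving L.
Proof.
elim=> {A B C L}.
- split=> //; exists [:: (@kid R A', @kid R B', @kid R C')] => rho.
  rewrite big_seq1 /= -[LHS]kact_id; apply: eq_kact => -[[a b] c] [[x y] z].
  by rewrite /ktens /kid /= !xpair_eqE -!mulnb !natrM.
- move=> A B C I A1 F next hF _ ih; split.
    apply: separable_sum => i; apply: separable_comp; first by case: (ih i).
    by apply: separable_actA; case: hF.
  move=> rho; rewrite raddf_sum /= -(instrument_tr rho (instrument_tens_id B hF)).
  by apply: eq_bigr => i _; rewrite (ih i).2 actAE.
- move=> A B C I A1 F next hF _ ih; split.
    apply: separable_sum => i; apply: separable_comp; first by case: (ih i).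
    by apply: separable_actB; case: hF.
  move=> rho; rewrite raddf_sum /= -(instrument_tr rho (instrument_id_tens A hF)).
  by apply: eq_bigr => i _; rewrite (ih i).2 actBE.
- move=> A B C I A1 F next hF _ ih; split.
    apply: separable_sum => i; apply: separable_comp; first by case: (ih i).
    by apply: separable_actC; case: hF.
  move=> rho; rewrite raddf_sum /= -(instrument_tr_r rho hF).
  by apply: eq_bigr => i _; rewrite (ih i).2 actCE.
Qed.

Lemma separable_kraus (A B C A' B' C' : finType)
    (L : op R (A * B * C)%type -> op R (A' * B' * C')%type) : separable L -> kraus L.
Proof.
move=> [s hs]; exists [seq ktens (ktens k.1.1 k.1.2) k.2 | k <- s] => rho.
by rewrite big_map hs.
Qed.
End Locc.

(** * Haar integrals *)

Section Haar.
Variable R : realType.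
Local Notation conj := (@Num.conj R[i]).

Lemma open_U2_measurable (O : set 'M[R[i]^o]_2) : open O ->
  measurable ([set U | O (val U)] : set (U2_borel R)).
Proof. by move=> oO; apply: sub_sigma_algebra; exists O. Qed.

(** Multiplication by -i keeps the modulus and moves the imaginary part to the real part. *)
Lemma normc_ge_Im (z : R[i]) : `|complex.Im z|%:C <= `|z|.
Proof.
have n1 : `|(0 -i* 1 : R[i])| = 1.
  apply/eqP; rewrite -(@pexpr_eq1 _ _ 2) //; apply/eqP; rewrite normCK.
  by apply/eqP; rewrite eq_complex /=; apply/andP; split; apply/eqP; ring.
case: z => x y; have := normc_ge_Re ((0 -i* 1) * (x +i* y)).
by rewrite normrM n1 mul1r /= mul0r sub0r mulNr mul1r opprK.
Qed.

Lemma open_Re_gt (x : R) : open ([set z | x < complex.Re z] : set R[i]^o).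
Proof.
rewrite openE => z /= xz; apply/nbhs_ballP; exists (complex.Re z - x)%:C => /=.
  by rewrite ltcR subr_gt0.
move=> y; rewrite -ball_normE /= => h.
have : `|complex.Re (z - y)|%:C < (complex.Re z - x)%:C.
  by apply: le_lt_trans h; exact: normc_ge_Re.
rewrite ltcR raddfB /= => /(le_lt_trans (ler_norm _)); lra.
Qed.

Lemma open_Im_gt (x : R) : open ([set z | x < complex.Im z] : set R[i]^o).
Proof.
rewrite openE => z /= xz; apply/nbhs_ballP; exists (complex.Im z - x)%:C => /=.
  by rewrite ltcR subr_gt0.
move=> y; rewrite -ball_normE /= => h.
have : `|complex.Im (z - y)|%:C < (complex.Im z - x)%:C.
  by apply: le_lt_trans h; exact: normc_ge_Im.
rewrite ltcR raddfB /= => /(le_lt_trans (ler_norm _)); lra.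
Qed.

(** Bounded measurable functions: a class stable under sums, products and conjugation, hence
    containing the entries of the twirl integrand, and integrable for a probability. *)
Definition bmeas (f : U2_borel R -> R[i]) :=
  [/\ measurable_fun setT (fun U => complex.Re (f U)),
      measurable_fun setT (fun U => complex.Im (f U)) &
      exists M : R, forall U, `|complex.Re (f U)| <= M /\ `|complex.Im (f U)| <= M].

Lemma measurable_gt (f : U2_borel R -> R) :
  (forall x, measurable ([set U | x < f U] : set (U2_borel R))) -> measurable_fun setT f.
Proof.
move=> h; apply: (measurability _ (RGenOInfty.measurableE R)) => _ [_ [x ->] <-].
rewrite setTI (_ : _ @^-1` _ = [set U | x < f U]) //.
by apply/seteqP; split=> U /=; rewrite in_itv /= andbT.
Qed.

Lemma norm_unitary_entry (U : U2 R) a b : `|val U a b| <= 1.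
Proof.
have /unitarymxP/matrixP/(_ a a) := valP U.
rewrite !mxE eqxx (bigD1 b) //= !mxE -normCK => e.
rewrite -(@expr_le1 _ 2) // -[leRHS]/(true%:R) -e lerDl sumr_ge0 // => i _.
by rewrite !mxE -normCK exprn_ge0.
Qed.

Lemma open_coord (D : set R[i]^o) a b : open D ->
  open [set M : 'M[R[i]^o]_2 | D (M a b)].
Proof.
rewrite !openE => oD M hM.
(* A neighbourhood of a matrix is given by neighbourhoods of its entries: [D] at position (a, b),
   everything elsewhere. *)
exists (fun i j => [set z | (i = a /\ j = b) -> D z]) => [i j|N /(_ a b) /=]; last exact.
have [[-> ->]|h] := pselect (i = a /\ j = b).
  by apply: filterS (oD _ hM) => z hz _.
by apply: filterS (@filterT _ (nbhs (M i j)) _) => z _ /h.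
Qed.

Lemma bmeas_coord a b : bmeas (fun U : U2_borel R => val U a b).
Proof.
split.
- apply: measurable_gt => x.
  exact: (open_U2_measurable (@open_coord _ a b (@open_Re_gt x))).
- apply: measurable_gt => x.
  exact: (open_U2_measurable (@open_coord _ a b (@open_Im_gt x))).
exists 1 => U; have h := norm_unitary_entry U a b.
split; rewrite -lecR; apply: le_trans h.
  exact: normc_ge_Re.
exact: normc_ge_Im.
Qed.

Lemma bmeas_cst c : bmeas (fun=> c).
Proof.
split; [exact: measurable_cst|exact: measurable_cst|].
exists (Num.max `|complex.Re c| `|complex.Im c|) => U.
by rewrite !le_max !lexx orbT.
Qed.

Lemma bmeasD f g : bmeas f -> bmeas g -> bmeas (fun U => f U + g U).
Proof.
move=> [f1 f2 [M hM]] [g1 g2 [N hN]]; split.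
- apply: eq_measurable_fun (measurable_funD f1 g1) => U _ /=; by rewrite raddfD.
- apply: eq_measurable_fun (measurable_funD f2 g2) => U _ /=; by rewrite raddfD.
exists (M + N) => U; have [a b] := hM U; have [c d] := hN U.
by rewrite !raddfD /=; split; apply: le_trans (ler_normD _ _) _; apply: lerD.
Qed.

Lemma bmeasM f g : bmeas f -> bmeas g -> bmeas (fun U => f U * g U).
Proof.
move=> [f1 f2 [M hM]] [g1 g2 [N hN]]; split.
- apply: eq_measurable_fun
    (measurable_funB (measurable_funM f1 g1) (measurable_funM f2 g2)) => U _ /=.
  by case: (f U); case: (g U).
- apply: eq_measurable_fun
    (measurable_funD (measurable_funM f1 g2) (measurable_funM f2 g1)) => U _ /=.
  by case: (f U); case: (g U).
exists (M * N + M * N) => U; have [a b] := hM U; have [c d] := hN U.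
case: (f U) (g U) a b c d => x y [z t] /= a b c d; split.
  by apply: le_trans (ler_normB _ _) _; rewrite !normrM; apply: lerD; apply: ler_pM.
by apply: le_trans (ler_normD _ _) _; rewrite !normrM; apply: lerD; apply: ler_pM.
Qed.

Lemma bmeas_conj f : bmeas f -> bmeas (fun U => conj (f U)).
Proof.
move=> [f1 f2 [M hM]]; split.
- by apply: eq_measurable_fun f1 => U _ /=; case: (f U).
- by apply: eq_measurable_fun (measurable_funN f2) => U _ /=; case: (f U).
exists M => U; have := hM U; case: (f U) => x y /=; by rewrite normrN.
Qed.

Lemma bmeas_sum (I : Type) (r : seq I) (f : I -> U2_borel R -> R[i]) :
  (forall i, bmeas (f i)) -> bmeas (fun U => \sum_(i <- r) f i U).
Proof.
move=> h; elim: r => [|i r ih].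
  by under eq_fun do rewrite big_nil; exact: bmeas_cst.
by under eq_fun do rewrite big_cons; exact: bmeasD.
Qed.

Variable mu : probability (U2_borel R) R.

Lemma bounded_integrable (f : U2_borel R -> R) M : measurable_fun setT f ->
  (forall U, `|f U| <= M) -> mu.-integrable setT (EFin \o f).
Proof.
move=> mf h; apply: measurable_bounded_integrable => //.
  by apply: le_lt_trans (probability_le1 mu measurableT) _; exact: ltry.
exists M; split; first exact: num_real.
by move=> N MN U _ /=; apply: le_trans (h U) (ltW MN).
Qed.

Lemma bmeas_integrable f : bmeas f ->
  mu.-integrable setT (EFin \o (fun U => complex.Re (f U))) /\
  mu.-integrable setT (EFin \o (fun U => complex.Im (f U))).
Proof.
by move=> [f1 f2 [M hM]]; split; apply: (@bounded_integrable _ M) => // U; case: (hM U).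
Qed.

Lemma cintegralD f g : bmeas f -> bmeas g ->
  cintegral mu (fun U => f U + g U) = cintegral mu f + cintegral mu g.
Proof.
move=> /bmeas_integrable[f1 f2] /bmeas_integrable[g1 g2]; rewrite /cintegral.
under eq_Rintegral do rewrite raddfD /=.
under [X in _ +i* X]eq_Rintegral do rewrite raddfD /=.
by rewrite !RintegralD.
Qed.

Lemma cintegral_cst c : cintegral mu (fun=> c) = c.
Proof.
have h : fine (mu setT) = 1 by rewrite (_ : mu setT = 1%E) //; exact: probability_setT.
rewrite /cintegral !Rintegral_cst // h !mulr1; by case: c.
Qed.

Lemma cintegralZ c f : bmeas f -> cintegral mu (fun U => c * f U) = c * cintegral mu f.
Proof.
move=> gf; have [f1 f2] := bmeas_integrable gf; rewrite /cintegral; case: c => x y.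
transitivity ((x * \int[mu]_U complex.Re (f U) + (- y) * \int[mu]_U complex.Im (f U)) +i*
   (x * \int[mu]_U complex.Im (f U) + y * \int[mu]_U complex.Re (f U))); last first.
  by congr (_ +i* _); rewrite mulNr.
have i c g : mu.-integrable setT (EFin \o g) ->
    mu.-integrable setT (EFin \o (fun U => c * g U)).
  move=> ig; by have := integrableZl measurableT c ig; apply: eq_integrable.
congr (_ +i* _).
  rewrite -!RintegralZl // -RintegralD //; [|exact: i..].
  by apply: eq_Rintegral => U _; case: (f U) => u v /=; rewrite mulNr.
rewrite -!RintegralZl // -RintegralD //; [|exact: i..].
by apply: eq_Rintegral => U _; case: (f U) => u v /=.
Qed.

Lemma cintegral_sum (I : Type) (r : seq I) (f : I -> U2_borel R -> R[i]) :
  (forall i, bmeas (f i)) ->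
  cintegral mu (fun U => \sum_(i <- r) f i U) = \sum_(i <- r) cintegral mu (f i).
Proof.
move=> h; elim: r => [|i r ih].
  by under eq_fun do rewrite big_nil; rewrite big_nil cintegral_cst.
under eq_fun do rewrite big_cons; rewrite big_cons cintegralD ?ih //.
exact: bmeas_sum.
Qed.

(** Left multiplication is continuous, each entry of the product being a sum of two constant
    multiples of coordinates, so generating open sets pull back to open sets. *)
Lemma measurable_U2_mul (V : U2 R) :
  measurable_fun setT (U2_mul V : U2_borel R -> U2_borel R).
Proof.
apply: (measurability _ (erefl (@measurable _ (U2_borel R)))).
move=> A0 [B [D Dopen defB] defA]; rewrite -defA defB; rewrite setTI.
apply: (@open_U2_measurable [set M | D (val V *m M)]).
have Dopen2 := Dopen; rewrite openE in Dopen2; rewrite openE => M hM.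
have [P hP sPA] := Dopen2 _ hM.
suff : \forall N \near M, forall i j, P i j ((val V *m N) i j).
  by apply: filterS => N hN; exact: sPA.
refine (@filter_forall _ _ (fun i N => forall j, P i j ((val V *m N) i j)) (nbhs M) _ _) => i.
refine (@filter_forall _ _ (fun j N => P i j ((val V *m N) i j)) (nbhs M) _ _) => j.
pose f k := fun N : 'M[R[i]^o]_2 => (val V i k : R[i]^o) * (N k j : R[i]^o).
have fM k : f k N @[N --> (M : 'M[R[i]^o]_2)] --> f k M.
  apply: (@cvgM _ _ (nbhs (M : 'M[R[i]^o]_2)) _ (fun=> val V i k) (fun N => N k j)).
    exact: cvg_cst.
  exact: coord_continuous.
have sum_f (N : 'M[R[i]^o]_2) : (val V *m N) i j = f 0 N + f 1 N.
  rewrite mxE big_ord_recl big_ord1 /f; congr (_ + val V i _ * N _ j); exact: val_inj.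
have := @cvgD _ (R[i]^o) _ (nbhs (M : 'M[R[i]^o]_2)) _ (f 0) (f 1) _ _ (fM 0) (fM 1).
rewrite -sum_f => /(_ (nbhs_filter (M : 'M[R[i]^o]_2)) _ (hP i j)).
apply: (@filterS _ (nbhs (M : 'M[R[i]^o]_2)) (nbhs_filter _)) => N h; rewrite sum_f; exact: h.
Qed.

(** Change of variables: the pushforward of [mu] by left translation is [mu] itself; applied to the
    real and imaginary parts separately. *)
Lemma cintegral_haar (V : U2 R) f : is_haar mu -> bmeas f ->
  cintegral mu (fun U => f (U2_mul V U)) = cintegral mu f.
Proof.
move=> hmu [f1 f2 [M hM]].
have key (g : U2_borel R -> R) : measurable_fun setT g -> (forall U, `|g U| <= M) ->
    \int[mu]_U g (U2_mul V U) = \int[mu]_U g U.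
  move=> mg hg; congr fine.
  pose T : U2_borel R -> U2_borel R := U2_mul V.
  have mT : measurable_fun setT T := measurable_U2_mul V.
  have mg' : measurable_fun setT (EFin \o g) by exact/measurable_EFinP.
  have ig : mu.-integrable (T @^-1` setT) ((EFin \o g) \o T).
    apply: (@bounded_integrable (g \o T) M) => [|U /=]; last exact: hg.
    exact: measurableT_comp mT.
  have := integral_pushforward mT mg' ig measurableT.
  rewrite preimage_setT => <-.
  by apply: eq_measure_integral => A mA _; exact: (hmu V A mA).
congr (_ +i* _).
  by apply: key f1 _ => U; case: (hM U).
by apply: key f2 _ => U; case: (hM U).
Qed.
End Haar.

(** * The Haar twirl is the isotropic map *)

Section Twirl.
Variable R : realType.
Local Notation conj := (@Num.conj R[i]).
Variable mu : probability (U2_borel R) R.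

Definition U2_fun (U : U2 R) (a b : qubit) : R[i] := val U a b.

Lemma U_Uconj_act (U : U2 R) s :
  U_Uconj U *m s *m (U_Uconj U)^t* = Ubar_act (U2_fun U) s.
Proof. by rewrite mulmx_kact; apply: eq_kact => -[a b] [c d]; rewrite entry_opmx. Qed.

Lemma entry_twirl s x y :
  entry (twirl mu s) x y = cintegral mu (fun U => entry (Ubar_act (U2_fun U) s) x y).
Proof.
rewrite /entry mxE; congr cintegral; apply: funext => U.
by rewrite U_Uconj_act.
Qed.

Lemma bmeas_Ubar_act s x y : bmeas (fun U => entry (Ubar_act (U2_fun U) s) x y).
Proof.
under eq_fun do rewrite entry_opmx.
apply: bmeas_sum => u; apply: bmeas_sum => v.
apply: bmeasM; last apply: bmeas_conj.
  apply: bmeasM (bmeas_cst _).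
  apply: bmeasM; last apply: bmeas_conj; exact: bmeas_coord.
apply: bmeasM; last apply: bmeas_conj; exact: bmeas_coord.
Qed.

Lemma Ubar_act_mul (V U : U2 R) s :
  Ubar_act (U2_fun V) (Ubar_act (U2_fun U) s) = Ubar_act (U2_fun (U2_mul V U)) s.
Proof.
rewrite /Ubar_act kact_comp; apply: eq_kact => y x; rewrite kcomp_tens.
rewrite /ktens /kcomp /U2_fun /= !mxE rmorph_sum; congr (_ * _).
by apply: eq_bigr => z _; rewrite rmorphM.
Qed.

(** By linearity the action of [V] passes under the integral, where it composes with that of [U]
    into that of V U; left invariance absorbs [V]. *)
Lemma twirl_invariant (V : U2 R) s : is_haar mu ->
  Ubar_act (U2_fun V) (twirl mu s) = twirl mu s.
Proof.
move=> hmu; apply: entry_ext => x y; rewrite [RHS]entry_twirl.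
rewrite -(cintegral_haar V hmu (bmeas_Ubar_act s x y)).
pose K := ktens (U2_fun V) (fun a b => conj (U2_fun V a b)).
transitivity (cintegral mu (fun U => \sum_u \sum_v (K x u * conj (K y v)) *
    entry (Ubar_act (U2_fun U) s) u v)); last first.
  congr cintegral; apply: funext => U; rewrite -Ubar_act_mul entry_opmx.
  by apply: eq_bigr => u _; apply: eq_bigr => v _; rewrite mulrAC.
have gd u v : bmeas (fun U => (K x u * conj (K y v)) * entry (Ubar_act (U2_fun U) s) u v).
  by apply: bmeasM (bmeas_cst _) (bmeas_Ubar_act _ _ _).
rewrite cintegral_sum => [|u]; last exact: bmeas_sum.
rewrite entry_opmx; apply: eq_bigr => u _; rewrite cintegral_sum //.
apply: eq_bigr => v _; rewrite entry_twirl cintegralZ; last exact: bmeas_Ubar_act.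
by rewrite mulrAC.
Qed.

Lemma isometric_U2 (K : qubit -> qubit -> R[i]) : isometric K ->
  exists V : U2 R, U2_fun V = K.
Proof.
move=> hK; pose M : 'M[R[i]]_2 := \matrix_(a, b) K a b.
have hM : M \is unitarymx.
  apply/unitarymxP/mulmx1C/matrixP => a b; rewrite !mxE eq_sym -hK.
  by apply: eq_bigr => c _; rewrite !mxE.
exists (exist _ M hM); apply: funext => a; apply: funext => b.
by rewrite /U2_fun /= mxE.
Qed.

Lemma mix_invariant (J : finType) (U : J -> qubit -> qubit -> R[i]) s :
  (0 < #|J|)%N -> (forall j, Ubar_act (U j) s = s) -> mix U s = s.
Proof.
move=> J0 h; rewrite /mix (eq_bigr (fun=> s)) // sumr_const -[s *+ _]scaler_nat scalerA.
by rewrite mulVf ?scale1r // pnatr_eq0 -lt0n.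
Qed.

(** Heisenberg picture: the adjoint of [K] acts on the vector of the pure effect. *)
Lemma tr_pure_mul_kact (X Y : finType) (f : Y -> R[i]) (K : Y -> X -> R[i]) rho :
  \tr (pure f *m kact K rho) = \tr (pure (fun x => \sum_y conj (K y x) * f y) *m rho).
Proof.
rewrite !tr_mul_pure.
transitivity (\sum_y \sum_y' \sum_x \sum_x'
  (conj (f y) * K y x) * entry rho x x' * (conj (K y' x') * f y')).
  apply: eq_bigr => y _; apply: eq_bigr => y' _; rewrite entry_opmx mulr_sumr mulr_suml.
  apply: eq_bigr => x _; rewrite mulr_sumr mulr_suml; apply: eq_bigr => x' _; ring.
under eq_bigr do rewrite exchange_big /=.
rewrite exchange_big /=; apply: eq_bigr => x _.
under eq_bigr do rewrite exchange_big /=.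
rewrite exchange_big /=; apply: eq_bigr => x' _.
rewrite rmorph_sum mulr_suml mulr_suml; apply: eq_bigr => y _.
by rewrite mulr_sumr; apply: eq_bigr => y' _; rewrite rmorphM /= conjCK; ring.
Qed.

Lemma U2_isometric (U : U2 R) : isometric (U2_fun U).
Proof.
move=> x x'; have /unitarymxP/mulmx1C/matrixP/(_ x' x) := valP U.
by rewrite !mxE [in RHS]eq_sym => <-; apply: eq_bigr => y _; rewrite !mxE.
Qed.

(** Psi+ is fixed by the adjoint of U tensored with its conjugate: the transformed amplitudes are
    the entries of U^dagger U over sqrt 2. *)
Lemma epr_Ubar_act U s : isometric U ->
  \tr (epr R *m Ubar_act U s) = \tr (epr R *m s).
Proof.
move=> hU; rewrite tr_pure_mul_kact; congr (\tr (_ *m s)); congr pure.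
apply: funext => -[x y]; rewrite sum_pair /ktens /=.
transitivity (inv_sqrt2 R * \sum_a conj (U a x) * U a y).
  rewrite mulr_sumr; apply: eq_bigr => a _; rewrite (bigD1 a) //= big1 => [|b nb].
    by rewrite addr0 /epr_amp eqxx rmorphM /= conjCK; ring.
  by rewrite /epr_amp /= eq_sym (negPf nb) mulr0.
by rewrite hU /epr_amp /= eq_sym; case: eqP; rewrite ?mulr1 ?mulr0.
Qed.

Lemma tr_Ubar_act (U : qubit -> qubit -> R[i]) s : isometric U -> \tr (Ubar_act U s) = \tr s.
Proof.
move=> hU; have t1 := tr_kact_isometric hU.
have t2 : trace_preserving (kact (fun a b => conj (U a b))).
  apply: tr_kact_isometric => x x'; rewrite eq_sym -hU.
  by apply: eq_bigr => a _; rewrite conjCK mulrC.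
rewrite -(@tr_tens_id R _ _ qubit _ s t1) -(tr_id_tens (tens_id (kact U) s) t2).
rewrite id_tens_kact tens_id_kact kact_comp; congr (\tr _); apply: eq_kact => y x.
by rewrite kcomp_tens /ktens kidcomp kcompid.
Qed.

Lemma twirl_isotropic s : is_haar mu -> twirl mu s = isotropic s.
Proof.
move=> hmu.
have mixE (J : finType) (U : J -> qubit -> qubit -> R[i]) : (0 < #|J|)%N ->
    (forall j, isometric (U j)) -> mix U (twirl mu s) = twirl mu s.
  move=> J0 hU; apply: mix_invariant => // j.
  by have [V <-] := isometric_U2 (hU j); exact: twirl_invariant.
have e : isotropic (twirl mu s) = twirl mu s.
  by rewrite -isotropic_mix !mixE ?card_bool ?card_ord // => j;
    first [exact: isometric_pauliZ|exact: isometric_pauliX|exact: isometric_cliff3].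
(* The twirl being isotropic, only its trace and its overlap with Psi+ remain to be found; for both,
   the integrand is constant in U. *)
rewrite -e /isotropic.
have -> : \tr (twirl mu s) = \tr s.
  rewrite trE; under eq_bigr do rewrite entry_twirl.
  rewrite -cintegral_sum; last by move=> x; exact: bmeas_Ubar_act.
  rewrite -[RHS](cintegral_cst mu); congr cintegral; apply: funext => U.
  by rewrite -trE tr_Ubar_act //; exact: U2_isometric.
suff -> : \tr (epr R *m twirl mu s) = \tr (epr R *m s) by [].
rewrite -[RHS](cintegral_cst mu).
rewrite (_ : (fun=> _) = fun U : U2_borel R => \sum_p \sum_q
    entry (epr R) p q * entry (Ubar_act (U2_fun U) s) q p); last first.
  apply: funext => U; rewrite -(epr_Ubar_act s (U2_isometric U)) trE.
  by apply: eq_bigr => p _; rewrite entryM.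
rewrite cintegral_sum; last first.
  by move=> p; apply: bmeas_sum => q;
     apply: bmeasM (bmeas_cst _) (bmeas_Ubar_act _ _ _).
rewrite trE; apply: eq_bigr => p _; rewrite entryM cintegral_sum; last first.
  by move=> q; apply: bmeasM (bmeas_cst _) (bmeas_Ubar_act _ _ _).
apply: eq_bigr => q _; rewrite entry_twirl cintegralZ //; exact: bmeas_Ubar_act.
Qed.
End Twirl.

(** * Converse bound *)

Section UpperBound.
Variable R : realType.
Variables (S C S' : finType) (N Nbar : op R (S * C)%type -> op R S') (F : op R S').
Hypotheses (kN : kraus N) (kNbar : kraus Nbar) (psdF : psd F) (trF : \tr F = 1).
(** In the completely positive order [N] lies below twice the constant channel to [F], and [Nbar] is
    the difference. *)
Hypothesis sumN : forall rho, N rho + Nbar rho = (2 * \tr rho) *: F.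

Let T (rho : op R (S * C)%type) : op R S' := measure_prepare 1%:M F rho.

Lemma use_box_sum (X Y : finType) (rho : op R ((S * X) * (C * Y))%type) :
  use_box N rho + use_box Nbar rho = 2 *: use_box T rho.
Proof.
apply: entry_ext => -[[s x] y] [[s' x'] y']; rewrite entryD entryZ !entry_opmx.
by rewrite -entryD sumN /T /measure_prepare mul1mx !entryZ mulrA.
Qed.

(** The effect of the constant channel on the receiver alone: the part of [sigma] fed into the box
    is traced out and a fresh [F] takes its place. *)
Definition discard_input (X : finType) (sigma : op R (S * X)%type) : op R (S' * X)%type :=
  opmx (fun p q => entry F p.1 q.1 * \sum_t entry sigma (t, p.2) (t, q.2)).

Lemma ptrace_r_use_box (X Y : finType) (rho : op R ((S * X) * (C * Y))%type) :
  ptrace_r (use_box T rho) = discard_input (ptrace_r rho).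
Proof.
apply: entry_ext => -[s x] [s' x']; rewrite !entry_opmx /=.
under eq_bigr do rewrite entry_opmx entryZ mul1mx trE sum_pair.
rewrite -mulr_suml mulrC exchange_big; congr (_ * _); apply: eq_bigr => t _ /=.
rewrite entry_opmx sum_pair exchange_big; apply: eq_bigr => c _ /=.
by apply: eq_bigr => y _; rewrite entry_opmx.
Qed.

Lemma tr_discard_input (X : finType) (sigma : op R (S * X)%type) :
  \tr (discard_input sigma) = \tr sigma.
Proof.
rewrite !trE !sum_pair -[RHS]mul1r -trF trE mulr_suml; apply: eq_bigr => s _.
rewrite [in RHS]exchange_big mulr_sumr; apply: eq_bigr => x _.
by rewrite entry_opmx.
Qed.

(* tau is what the protocol prepares when every use of N is replaced by the
   constant channel T, through which the sender conveys nothing. *)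
Lemma transmission_bound (M : Type) n (X Y : finType) (st : M -> op R (X * Y)%type) :
  transmission N n st ->
  exists (tau : M -> op R (X * Y)%type) (sigma : op R X),
    [/\ forall m, psd (st m), forall m, psd (tau m),
        forall m, psd (2 ^+ n *: tau m - st m),
        forall m, ptrace_r (tau m) = sigma & \tr sigma = 1].
Proof.
have kT : kraus T by apply: kraus_measure_prepare => //; exact: psd1.
elim=> {n X Y st}.
- move=> X Y rho [psd_rho tr_rho]; exists (fun=> rho), (ptrace_r rho); split=> [//|//|_|//|].
    by rewrite expr0 scale1r subrr; exact: psd0.
  by rewrite tr_ptrace_r.
- move=> n X Y X' st Phi _ [tau [sigma [h1 h2 h3 h4 h5]]] [cPhi trPhi].
  have kPhi := kraus_tens_id Y (cp_kraus cPhi); have lPhi := kraus_linear kPhi.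
  exists (fun m => tens_id Phi (tau m)), (Phi sigma); split=> [m|m|m|m|].
  + exact: psd_kraus kPhi (h1 m).
  + exact: psd_kraus kPhi (h2 m).
  + have := psd_kraus kPhi (h3 m).
    by rewrite (linear_scaleB lPhi).
  + by rewrite ptrace_r_tens_id ?h4 //; case: cPhi.
  + by rewrite trPhi.
- move=> n X Y Y' st Phi _ [tau [sigma [h1 h2 h3 h4 h5]]] cPhi.
  have kPhi m := kraus_id_tens X (cp_kraus (cPhi m).1).
  exists (fun m => id_tens (Phi m) (tau m)), sigma; split=> [m|m|m|m|//].
  + exact: psd_kraus (kPhi m) (h1 m).
  + exact: psd_kraus (kPhi m) (h2 m).
  + have := psd_kraus (kPhi m) (h3 m); have lPhi := kraus_linear (kPhi m).
    by rewrite (linear_scaleB lPhi).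
  + by rewrite ptrace_r_id_tens ?h4 //; case: (cPhi m).
- move=> n X Y st _ [tau [sigma [h1 h2 h3 h4 h5]]].
  have kuT := kraus_use_box X Y kT; have luT := kraus_linear kuT.
  exists (fun m => use_box T (tau m)), (discard_input sigma); split=> [m|m|m|m|].
  + exact: psd_kraus (kraus_use_box X Y kN) (h1 m).
  + exact: psd_kraus kuT (h2 m).
  + have psd_a := psd_kraus kuT (h3 m).
    have psd_b := psd_kraus (kraus_use_box X Y kNbar) (h1 m).
    rewrite (linear_scaleB luT) in psd_a.
    (* The new gap is twice the image under T of the old gap, plus the output of [Nbar]; both terms
       are positive. *)
    have -> : 2 ^+ n.+1 *: use_box T (tau m) - use_box N (st m) =
        2 *: (2 ^+ n *: use_box T (tau m) - use_box T (st m)) + use_box Nbar (st m).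
      rewrite scalerBr -use_box_sum scalerA -exprS opprD -!addrA addNr addr0 //.
    by apply: psdD psd_b; apply: psdZ psd_a.
  + by rewrite ptrace_r_use_box h4.
  + by rewrite tr_discard_input.
Qed.

(** Message [m] is decoded with probability at most 2^n tr (D m sigma), where [sigma] is the same
    for all messages; the POVM elements sum to 1, so these bounds add up to 2^n. *)
Lemma reliable_code_bound n M (e : R) : reliable_code N n M e ->
  M%:R * (1 - e) <= 2 ^+ n.
Proof.
move=> [X [Y [st [D [tr_st psdD sumD succ]]]]].
have [tau [sigma [h1 h2 h3 h4 h5]]] := transmission_bound tr_st.
have le m : (1 - e)%:C <= 2 ^+ n * \tr (D m *m sigma).
  apply: le_trans (succ m) _; rewrite -subr_ge0.
  have kp := @kraus_ptrace_r R X Y; have lp := kraus_linear kp.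
  have := psd_tr_mul_ge0 (psdD m) (psd_kraus kp (h3 m)).
  rewrite (linear_scaleB lp) h4.
  by rewrite mulmxBr -scalemxAr raddfB /= mxtraceZ.
have : \sum_(m < M) (1 - e)%:C <= \sum_(m < M) 2 ^+ n * \tr (D m *m sigma).
  exact: ler_sum.
have -> : \sum_(m < M) 2 ^+ n * \tr (D m *m sigma) = 2 ^+ n.
  by rewrite -mulr_sumr -(raddf_sum (@mxtrace _ _)) -mulmx_suml sumD mul1mx /= h5 mulr1.
rewrite sumr_const card_ord.
rewrite -[_ *+ _]mulr_natl -(rmorph_nat (real_complex R)) -rmorphM.
by rewrite -(rmorph_nat (real_complex R) 2) -rmorphXn lecR.
Qed.

Lemma achievable_le1 r : achievable N r -> r <= 1.
Proof.
move=> [M [e [code e0 M_ge]]]; rewrite leNgt; apply/negP => r1.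
(* With these thresholds M (1 - e) is at least 2^((r - 1) n) 2^n / 2 >= 2 * 2^n, which exceeds the
   bound 2^n. *)
have [n [M_n e_n n1]] : exists n, [/\ 2 `^ (r * n%:R) <= (M n)%:R, e n < 2^-1
    & (2 : R) < (r - 1) * n%:R].
  have e_half : \forall n \near \oo, e n < 2^-1.
    by apply: (cvgr_lt 0 e0); rewrite invr_gt0.
  have big : \forall n \near \oo, (2 : R) < (r - 1) * n%:R.
    near=> n; rewrite mulrC -ltr_pdivrMr ?subr_gt0 //.
    near: n; exact: nbhs_infty_gtr.
  by have [n [[a b] c]] := filter_ex (filterI (filterI M_ge e_half) big); exists n.
have := reliable_code_bound (code n); apply/negP; rewrite -ltNge.
have p0 : 0 < (2 : R) `^ (r * n%:R) by exact: powR_gt0.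
apply: (@lt_le_trans _ _ (2 `^ (r * n%:R) * 2^-1)); last first.
  by apply: ler_pM; rewrite ?powR_ge0 ?invr_ge0 //; lra.
have -> : r * n%:R = (r - 1) * n%:R + n%:R by ring.
rewrite powRD ?pnatr_eq0 ?implybT // powR_mulrn // mulrAC.
have le4 : 4 <= (2 : R) `^ ((r - 1) * n%:R).
  have -> : (4 : R) = 2 `^ 2%:R by rewrite powR_mulrn //; ring.
  by apply: ler_powR; [lra|exact: ltW].
have p2 : 0 < (2 : R) ^+ n by rewrite exprn_gt0.
rewrite -[ltLHS]mul1r ltr_pM2r //; lra.
Unshelve. all: by end_near.
Qed.
End UpperBound.

(** * A zero-error code *)

Section Code.
Variable R : realType.
Local Notation conj := (@Num.conj R[i]).
Variables (S C S' : finType) (N : op R (S * C)%type -> op R S').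
Variables (phi : S * C -> R[i]) (z : C -> R[i]) (P : op R S').

(** The sender encodes [true] by the diagonal unitary with entries [z] on C, and [false] by doing
    nothing. *)
Let phase (b : bool) c := if b then z c else 1.
Let phib b p := phase b p.2 * phi p.

Hypotheses (lN : linear N) (psdP : psd P) (psdPc : psd (1%:M - P)).
Hypothesis (tr_phi : \tr (pure phi) = 1).
Hypothesis (zz : forall c, z c * conj (z c) = 1).
Hypothesis N_phi : forall b, \tr (P *m N (pure (phib b))) = (~~ b)%:R.
Hypothesis N_phi_compl : forall b, \tr ((1%:M - P) *m N (pure (phib b))) = b%:R.

Definition basis_state (X : finType) (x : X) : op R X := pure (fun y => (y == x)%:R).

Definition measure_bit (s : op R S') : op R bool :=
  measure_prepare P (basis_state false) s + measure_prepare (1%:M - P) (basis_state true) s.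

Lemma tr_basis_state (X : finType) (x : X) : \tr (basis_state x) = 1.
Proof.
rewrite trE -[RHS](sum_delta x (fun=> 1)); apply: eq_bigr => y _.
by rewrite entry_pure conjC_nat mulr1 eq_sym -natrM mulnb andbb.
Qed.

Lemma channel_measure_bit : channel measure_bit.
Proof.
apply: channel_kraus.
  by apply: krausD; apply: kraus_measure_prepare => //; exact: psd_pure.
move=> s; rewrite mxtraceD !mxtraceZ !tr_basis_state !mulr1 -raddfD /= -mulmxDl.
by rewrite addrC subrK mul1mx.
Qed.

Lemma measure_bit_phi b : measure_bit (N (pure (phib b))) = basis_state b.
Proof.
rewrite /measure_bit /measure_prepare N_phi N_phi_compl.
by case: b; rewrite /= ?scale0r ?scale1r ?addr0 ?add0r.
Qed.

(** The input of the box is in a product state with the memories, so the bit is read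
    deterministically and the memory state [h] survives untouched. *)
Lemma use_measure (X Y : finType) b (h : X * Y -> R[i]) :
  tens_id (@tens_id R _ _ X measure_bit) (use_box N
    (pure (fun q : (S * X) * (C * Y) => phib b (q.1.1, q.2.1) * h (q.1.2, q.2.2)))) =
  pure (fun p : (bool * X) * Y => (p.1.1 == b)%:R * h (p.1.2, p.2)).
Proof.
have blk x y x' y' : opmx (fun '(t, c) '(t', c') =>
    entry (pure (fun q : (S * X) * (C * Y) => phib b (q.1.1, q.2.1) * h (q.1.2, q.2.2)))
      ((t, x), (c, y)) ((t', x'), (c', y'))) =
    (h (x, y) * conj (h (x', y'))) *: pure (phib b).
  apply: entry_ext => -[t c] [t' c']; rewrite entryZ entry_opmx !entry_pure /=.
  by rewrite rmorphM /=; ring.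
have lm : linear measure_bit by apply: kraus_linear; apply/cp_kraus; case: channel_measure_bit.
apply: entry_ext => -[[b1 x] y] [[b2 x'] y'].
rewrite entry_opmx /= entry_opmx /= entry_pure /=.
rewrite (_ : opmx _ = (h (x, y) * conj (h (x', y'))) *: N (pure (phib b))); last first.
  apply: entry_ext => s s'; rewrite entryZ !entry_opmx /=.
  by rewrite blk linear_scale // entryZ.
by rewrite linear_scale // measure_bit_phi entryZ entry_pure rmorphM /=; ring.
Qed.

(** The power X^n as a nested product, so that one use of the box consumes the head factor. *)
Fixpoint copies (X : finType) n : finType :=
  if n is n'.+1 then (X * copies X n')%type else unit.

Fixpoint copies_amp n : copies S n -> copies C n -> R[i] :=
  if n is n'.+1 return copies S n -> copies C n -> R[i]
  then fun s c => phi (s.1, c.1) * copies_amp s.2 c.2 else fun _ _ => 1.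

Lemma card_copies_bool n : #|copies bool n| = (2 ^ n)%N.
Proof. by elim: n => [|n ih]; rewrite ?card_unit // card_prod card_bool ih expnS. Qed.

Definition stage n (W : finType) (w : W) : op R ((copies S n * W) * copies C n)%type :=
  pure (fun p => copies_amp p.1.1 p.2 * (p.1.2 == w)%:R).

Lemma tr_pure (X : finType) (f : X -> R[i]) : \tr (pure f) = \sum_x f x * conj (f x).
Proof. by rewrite trE; apply: eq_bigr => x _; rewrite entry_pure. Qed.

Lemma tr_stage n (W : finType) (w : W) : \tr (stage n w) = 1.
Proof.
have amp1 : \sum_(s : copies S n) \sum_(c : copies C n)
    copies_amp s c * conj (copies_amp s c) = 1.
  elim: n => [|n ih] /=.
    by do 2!rewrite (big_pred1 tt) => [|[]//]; rewrite rmorph1 mulr1.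
  rewrite sum_pair -[RHS]tr_phi tr_pure sum_pair; apply: eq_bigr => s _.
  rewrite exchange_big sum_pair /=; apply: eq_bigr => c _.
  rewrite -[RHS]mulr1 -[in RHS]ih exchange_big mulr_sumr; apply: eq_bigr => s' _ /=.
  by rewrite mulr_sumr; apply: eq_bigr => c' _; rewrite rmorphM /=; ring.
rewrite tr_pure sum_pair sum_pair -[RHS]amp1; apply: eq_bigr => s _ /=.
rewrite exchange_big; apply: eq_bigr => c _ /=.
rewrite -[RHS](sum_delta w (fun=> copies_amp s c * conj (copies_amp s c))).
apply: eq_bigr => t _; rewrite rmorphM /= conjC_nat eq_sym.
by case: (w == t); rewrite /= ?mulr1 ?mulr0 ?mul0r ?mul1r.
Qed.

Lemma tens_id_relabel_pure (X X' Y : finType) (u : X' -> X) (g : X * Y -> R[i]) :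
  tens_id (relabel u) (pure g) = pure (fun p => g (u p.1, p.2)).
Proof. by apply: entry_ext => -[x y] [x' y']; rewrite !entry_opmx !entry_pure. Qed.

Definition sender_phase (Y : finType) b : op R (C * Y)%type -> op R (C * Y)%type :=
  kact (fun c c' => (c == c')%:R * phase b c.1).

Lemma channel_sender_phase (Y : finType) b : channel (@sender_phase Y b).
Proof.
apply: channel_kraus; first exact: kraus_kact.
apply: tr_kact_isometric => x x'.
rewrite -[RHS](sum_delta x (fun t => (t == x')%:R)); apply: eq_bigr => t _.
rewrite rmorphM /= conjC_nat [t == x]eq_sym.
have [<-|_] := eqVneq x t; last by rewrite !mul0r mulr0.
rewrite !mul1r -mulrA [conj _ * _]mulrC /phase.
by case: b; rewrite ?zz ?rmorph1 ?mulr1.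
Qed.

Lemma sender_phase_pure (X Y : finType) b (g : X * (C * Y) -> R[i]) :
  id_tens (@sender_phase Y b) (pure g) = pure (fun p => phase b p.2.1 * g p).
Proof.
rewrite id_tens_kact kact_pure; congr pure; apply: funext => -[x y].
rewrite -[RHS](sum_delta (x, y) (fun p => phase b y.1 * g p)); apply: eq_bigr => -[x' y'] _.
by rewrite /ktens /kid /= xpair_eqE -mulnb natrM; ring.
Qed.

Lemma transmission_stage n k (M W : finType) (f : M -> W) (h : M -> copies bool n) :
  transmission N k (fun m => stage n (f m)) ->
  transmission N (k + n) (fun m => basis_state ((f m, h m), tt)).
Proof.
elim: n k W f h => [|n ih] k W f h tr.
  have bij : bijective (fun p : W * unit => (p.2, p.1)).
    by exists (fun p => (p.2, p.1)) => -[].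
  have := tr_receiver tr (channel_relabel R bij); rewrite addn0.
  congr (transmission _ _ _); apply: funext => m; rewrite tens_id_relabel_pure.
  congr pure; apply: funext => -[[w u] u'] /=; rewrite mul1r !xpair_eqE.
  by case: u; case: u'; case: (h m); rewrite !eqxx !andbT.
(* One round: isolate the head copy, encode the next bit as a phase, use the box, measure, and
   append the bit to the record. *)
have bij1 : bijective (fun p : S * (copies S n * W) => ((p.1, p.2.1), p.2.2)).
  by exists (fun p => (p.1.1, (p.1.2, p.2))) => [[? []]|[[]]].
have tr1 := tr_receiver tr (channel_relabel R bij1).
have tr2 := tr_sender tr1 (fun m => channel_sender_phase (copies C n) (h m).1).
have tr3 := tr_receiver (tr_use tr2)
  (channel_tens_id (copies S n * W)%type channel_measure_bit).
have bij2 : bijective (fun p : copies S n * (W * bool) => (p.2.2, (p.1, p.2.1))).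
  by exists (fun p => (p.2.1, (p.2.2, p.1))) => [[? []]|[? []]].
have tr4 := tr_receiver tr3 (channel_relabel R bij2).
have {}ih := ih k.+1 (W * bool)%type (fun m => (f m, (h m).1)) (fun m => (h m).2).
have bij3 : bijective (fun p : W * (bool * copies bool n) => ((p.1, p.2.1), p.2.2)).
  by exists (fun p => (p.1.1, (p.1.2, p.2))) => [[? []]|[[]]].
rewrite -addSnnS.
suff /ih /tr_receiver /(_ (channel_relabel R bij3)) :
    transmission N k.+1 (fun m => stage n (f m, (h m).1)).
  congr (transmission _ _ _); apply: funext => m; rewrite tens_id_relabel_pure.
  congr pure; apply: funext => -[[w [b t]] u] /=; rewrite !xpair_eqE /=.
  by case: (h m) => ? ?; rewrite xpair_eqE !andbA.
move: tr4; congr (transmission _ _ _); apply: funext => m.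
rewrite tens_id_relabel_pure sender_phase_pure /=.
pose h0 (p : (copies S n * W) * copies C n) := copies_amp p.1.1 p.2 * (p.1.2 == f m)%:R.
have -> : (fun p : S * (copies S n * W) * (C * copies C n) =>
     phase (h m).1 p.2.1 *
     (phi (p.1.1, p.2.1) * copies_amp p.1.2.1 p.2.2 * (p.1.2.2 == f m)%:R)) =
   fun q => phib (h m).1 (q.1.1, q.2.1) * h0 (q.1.2, q.2.2).
  by apply: funext => q; rewrite /phib /h0 /=; ring.
rewrite use_measure /h0 tens_id_relabel_pure; congr pure; apply: funext => -[[t [w b]] c] /=.
by rewrite xpair_eqE -mulnb natrM; ring.
Qed.

(** The protocol starts from [n] copies and the empty record [tt]; the final records are distinct
    basis states, so a projective measurement decodes without error. *)
Lemma reliable_code_bits n : reliable_code N n #|copies bool n| 0.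
Proof.
exists (unit * copies bool n)%type, unit.
exists (fun m => basis_state ((tt, enum_val m), tt)), (fun m => basis_state (tt, enum_val m)).
split=> [|m||m].
- rewrite -[n in transmission _ n]add0n.
  apply: (@transmission_stage n 0 _ unit (fun=> tt) enum_val).
  by apply: tr_start; split; [exact: psd_pure|exact: tr_stage].
- exact: psd_pure.
- apply: entry_ext => -[[] x] [[] y]; rewrite entry_sum entry1.
  rewrite (reindex (@enum_rank _)) /=; last exact/onW_bij/enum_rank_bij.
  rewrite -[RHS](sum_delta x (fun t => ((tt, t) == (tt, y))%:R)).
  apply: eq_bigr => t _; rewrite enum_rankK entry_pure conjC_nat !xpair_eqE /=.
  by rewrite [y == t]eq_sym.
rewrite subr0 (_ : ptrace_r _ = basis_state (tt, enum_val m)).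
  by rewrite pure_mul_pure mxtraceZ tr_basis_state mulr1.
apply: entry_ext => x y; rewrite entry_opmx (big_pred1 tt) => [|[]//].
by rewrite !entry_pure ![in LHS]xpair_eqE !andbT.
Qed.

Lemma achievable1 : achievable N 1.
Proof.
exists (fun n => #|copies bool n|), (fun=> 0); split.
- exact: reliable_code_bits.
- exact: cvg_cst.
by near=> n; rewrite mul1r card_copies_bool powR_mulrn // natrX.
Unshelve. all: by end_near.
Qed.
End Code.

(** * Phase flips through separable maps *)

Section Flip.
Variable R : realType.
Local Notation conj := (@Num.conj R[i]).

Definition flip_sign (b : qubit) : R[i] := if b == q0 then 1 else -1.

Lemma norm_mul_mean (x y : R[i]) : 2 * `|x * y| <= `|x| ^+ 2 + `|y| ^+ 2.
Proof.
have : 0 <= (`|x| - `|y|) ^+ 2.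
  by apply: real_exprn_even_ge0; rewrite ?rpredB ?normr_real.
move=> h; rewrite -subr_ge0 normrM.
have -> : `|x| ^+ 2 + `|y| ^+ 2 - 2 * (`|x| * `|y|) = (`|x| - `|y|) ^+ 2 by ring.
exact: h.
Qed.

Lemma sum_normsq_eq0 (J : finType) (f : J -> R[i]) :
  \sum_j f j * conj (f j) = 0 -> forall j, f j = 0.
Proof.
move=> h j; have ge0 i : true -> 0 <= f i * conj (f i) by move=> _; exact: mul_conjC_ge0.
have : f j * conj (f j) = 0 by apply: (psumr_eq0P ge0 h).
rewrite -normCK => /eqP.
by rewrite expf_eq0 /= normr_eq0 => /eqP.
Qed.

(* Writing w = A G B^T and w' = A G Z B^T with w = l * 1, the matrix w' is
   similar to l * Z. *)
Lemma flip_scalar (n b w w' : qubit -> qubit -> R[i]) l :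
  (forall x y, w x y = n x q0 * b y q0 + n x q1 * b y q1) ->
  (forall x y, w' x y = n x q0 * b y q0 - n x q1 * b y q1) ->
  w q0 q1 = 0 -> w q1 q0 = 0 -> w q0 q0 = l -> w q1 q1 = l -> l != 0 ->
  w' q0 q0 + w' q1 q1 = 0 /\
  2 * `|l| ^+ 2 <= \sum_x \sum_y `|w' x y| ^+ 2.
Proof.
move=> hw hw'; rewrite !hw => e01 e10 e00 e11 l0.
set n00 := n q0 q0 in e01 e10 e00 e11 *; set n01 := n q0 q1 in e01 e10 e00 e11 *.
set n10 := n q1 q0 in e01 e10 e00 e11 *; set n11 := n q1 q1 in e01 e10 e00 e11 *.
set b00 := b q0 q0 in e01 e10 e00 e11 *; set b01 := b q0 q1 in e01 e10 e00 e11 *.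
set b10 := b q1 q0 in e01 e10 e00 e11 *; set b11 := b q1 q1 in e01 e10 e00 e11 *.
pose dn := n00 * n11 - n01 * n10; pose db := b00 * b11 - b01 * b10.
(* Determinants in w = n b^T, where [n] stands for A G. *)
have ed : dn * db = l ^+ 2.
  transitivity ((n00 * b00 + n01 * b01) * (n10 * b10 + n11 * b11)
     - (n00 * b10 + n01 * b11) * (n10 * b00 + n11 * b01)); first by rewrite /dn /db; ring.
  by rewrite e01 e10 e00 e11; ring.
have dn0 : dn != 0.
  by apply/eqP => d0; move: ed; rewrite d0 mul0r => /esym/eqP; rewrite expf_eq0 (negPf l0).
split.
  (* After multiplication by the nonzero [dn], the adjugate of [n] eliminates [b] in favour of the
     entries of [w]. *)
  apply: (mulfI dn0); rewrite !hw' -/n00 -/n01 -/n10 -/n11 -/b00 -/b01 -/b10 -/b11 mulr0.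
  have -> : dn * (n00 * b00 - n01 * b01 + (n10 * b10 - n11 * b11)) =
     n00 * (n11 * (n00 * b00 + n01 * b01) - n01 * (n10 * b00 + n11 * b01))
     - n01 * (n00 * (n10 * b00 + n11 * b01) - n10 * (n00 * b00 + n01 * b01))
     + n10 * (n11 * (n00 * b10 + n01 * b11) - n01 * (n10 * b10 + n11 * b11))
     - n11 * (n00 * (n10 * b10 + n11 * b11) - n10 * (n00 * b10 + n01 * b11)).
    by rewrite /dn; ring.
  by rewrite e01 e10 e00 e11; ring.
have dw : w' q0 q0 * w' q1 q1 - w' q0 q1 * w' q1 q0 = - l ^+ 2.
  rewrite !hw' -ed -/n00 -/n01 -/n10 -/n11 -/b00 -/b01 -/b10 -/b11 /dn /db; ring.
(* As |l|^2 = |det w'|, the bound is 2 |x t - y u| <= |x|^2 + |t|^2 + |y|^2 + |u|^2. *)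
rewrite -normrX -normrN -dw; apply: le_trans (ler_wpM2l _ (ler_normB _ _)) _ => //.
rewrite mulrDr; apply: le_trans (lerD (norm_mul_mean _ _) (norm_mul_mean _ _)) _.
by rewrite !sum_qubit le_eqVlt; apply/orP; left; apply/eqP; ring.
Qed.

Lemma flip_trace0 (J : finType) (w w' : J -> qubit * qubit -> R[i]) :
  (forall j, exists (al G be : qubit -> qubit -> R[i]),
     (forall x y, w j (x, y) = \sum_a \sum_b al x a * G a b * be y b) /\
     (forall x y, w' j (x, y) = \sum_a \sum_b al x a * G a b * flip_sign b * be y b)) ->
  (forall x y, \sum_j w j x * conj (w j y) = entry (epr R) x y) ->
  \sum_j \sum_x w' j x * conj (w' j x) = 1 ->
  forall j, w' j (q0, q0) + w' j (q1, q1) = 0.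
Proof.
move=> form hepr tr1.
have sq0 := @sum_normsq_eq0 J.
(* The quadratic form of [epr R] vanishes on |01>, |10> and |11> - |00>, hence so do these
   components of every [w j]: each is a multiple of Psi+. *)
have w01 : forall j, w j (q0, q1) = 0 by apply: sq0; rewrite hepr entry_epr /=; ring.
have w10 : forall j, w j (q1, q0) = 0 by apply: sq0; rewrite hepr entry_epr /=; ring.
have wdiag j : w j (q1, q1) = w j (q0, q0).
  apply/eqP; rewrite -subr_eq0; apply/eqP; move: j; apply: sq0.
  transitivity (\sum_j (w j (q1, q1) * conj (w j (q1, q1)) - w j (q1, q1) * conj (w j (q0, q0))
     - w j (q0, q0) * conj (w j (q1, q1)) + w j (q0, q0) * conj (w j (q0, q0)))).
    by apply: eq_bigr => j _; rewrite rmorphB /=; ring.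
  by rewrite !big_split /= !sumrN !hepr !entry_epr /=; ring.
pose sq (v : qubit * qubit -> R[i]) := \sum_x v x * conj (v x).
have sqE v : sq v = \sum_x \sum_y `|v (x, y)| ^+ 2.
  by rewrite /sq sum_pair; apply: eq_bigr => x _; apply: eq_bigr => y _; rewrite normCK.
have main j : (w j (q0, q0) != 0 -> w' j (q0, q0) + w' j (q1, q1) = 0) /\
    sq (w j) <= sq (w' j).
  have [al [G [be [h h']]]] := form j.
  pose n x b := \sum_a al x a * G a b.
  have hn x y : w j (x, y) = n x q0 * be y q0 + n x q1 * be y q1.
    by rewrite h exchange_big /= sum_qubit /n !mulr_suml.
  have hn' x y : w' j (x, y) = n x q0 * be y q0 - n x q1 * be y q1.
    rewrite h' exchange_big /= sum_qubit /n !mulr_suml -sumrN /flip_sign /=.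
    by congr (_ + _); apply: eq_bigr => a _; ring.
  have [l0|l0] := eqVneq (w j (q0, q0)) 0.
    split=> //.
    rewrite !sqE !sum_qubit w01 w10 wdiag l0 normr0 expr0n /= !addr0.
    by rewrite !addr_ge0 ?exprn_ge0.
  have [t0 le] := flip_scalar (w := fun x y => w j (x, y)) (w' := fun x y => w' j (x, y))
    hn hn' (w01 j) (w10 j) erefl (wdiag j) l0.
  split=> //; rewrite !sqE; apply: le_trans le.
  rewrite !sum_qubit w01 w10 wdiag normr0 expr0n /= addr0 add0r.
  by rewrite le_eqVlt; apply/orP; left; apply/eqP; ring.
(* The norms compare termwise while both families have total 1, so equality holds for each [j]. *)
have eqs j : sq (w' j) - sq (w j) = 0.
  have h : \sum_j (sq (w' j) - sq (w j)) = 0.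
    rewrite big_split /= sumrN tr1 /sq exchange_big /=.
    rewrite (eq_bigr (fun x => entry (epr R) x x)) => [|x _]; last exact: hepr.
    by rewrite -trE tr_epr subrr.
  by apply: (psumr_eq0P _ h) => // i _; rewrite subr_ge0; case: (main i).
(* When [w j] is zero, equality of norms makes [w' j] zero too. *)
move=> j; have [l0|l0] := eqVneq (w j (q0, q0)) 0; last by case: (main j) => + _; exact.
move/eqP: (eqs j); rewrite subr_eq0 [sq (w j)]sqE !sum_qubit w01 w10 wdiag l0.
rewrite normr0 expr0n /= !addr0 => /eqP e.
have z := sum_normsq_eq0 e.
by rewrite !z addr0.
Qed.

(** Tracing out [C'] splits each Kraus operator into one product operator per basis vector of [C'],
    so [flip_trace0] applies; the overlap with Psi+ is half the sum of the squared moduli of the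
    traces, all zero. *)
Lemma separable_flip (C C' : finType)
    (L : op R (qubit * qubit * C)%type -> op R (qubit * qubit * C')%type)
    (f f' : qubit * qubit * C -> R[i]) :
  separable L -> trace_preserving L ->
  (forall (al be : qubit -> qubit -> R[i]) (ga : C -> R[i]),
     exists G : qubit -> qubit -> R[i], forall x y,
     \sum_p al x p.1.1 * be y p.1.2 * ga p.2 * f p =
       \sum_a \sum_b al x a * G a b * be y b /\
     \sum_p al x p.1.1 * be y p.1.2 * ga p.2 * f' p =
       \sum_a \sum_b al x a * G a b * flip_sign b * be y b) ->
  \tr (pure f') = 1 -> ptrace_r (L (pure f)) = epr R ->
  \tr (epr R *m ptrace_r (L (pure f'))) = 0.
Proof.
move=> [s hs] trL form tr1 hepr.
pose k (j : 'I_(size s) * C') := tnth (in_tuple s) j.1.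
pose w g j (x : qubit * qubit) :=
  \sum_p ktens (ktens (k j).1.1 (k j).1.2) (k j).2 (x, j.2) p * g p.
have hL g x y : entry (ptrace_r (L (pure g))) x y = \sum_j w g j x * conj (w g j y).
  rewrite entry_opmx sum_pair exchange_big; apply: eq_bigr => c _ /=.
  rewrite hs entry_sum [LHS]big_tnth; apply: eq_bigr => i _.
  by rewrite kact_pure entry_pure.
have w0 : forall j, w f' j (q0, q0) + w f' j (q1, q1) = 0.
  apply: (@flip_trace0 _ (w f)) => [j|x y|].
  - have [G hG] := form (k j).1.1 (k j).1.2 ((k j).2 j.2).
    by exists (k j).1.1, G, (k j).1.2; split=> x y; case: (hG x y).
  - by rewrite -hL hepr.
  - rewrite exchange_big /= -tr1 -trL -tr_ptrace_r trE; apply: eq_bigr => x _.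
    by rewrite hL.
rewrite tr_epr_mul !hL -!big_split /= big1 ?mul0r // => j _.
transitivity ((w f' j (q0, q0) + w f' j (q1, q1)) * conj (w f' j (q0, q0) + w f' j (q1, q1))).
  by rewrite rmorphD /=; ring.
by rewrite w0 mul0r.
Qed.
End Flip.

(** * ES-boxes and GHZ-EPR boxes *)

Section Boxes.
Variable R : realType.
Local Notation conj := (@Num.conj R[i]).

Lemma isotropic_epr : isotropic (epr R) = epr R.
Proof. by rewrite /isotropic epr_idem tr_epr subrr scale0r addr0 scale1r. Qed.

(** Both E0 and E1 have maximally mixed marginals, so only the trace of [s] is visible on one
    side. *)
Lemma ptrace_r_isotropic (s : op R (qubit * qubit)%type) :
  ptrace_r (isotropic s) = (\tr s / 2) *: 1%:M.
Proof.
apply: entry_ext; elim/qubitP; elim/qubitP;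
  by rewrite entry_opmx sum_qubit !entry_isotropic !entry_epr entryZ entry1 /=; field.
Qed.

Lemma ptrace_l_isotropic (s : op R (qubit * qubit)%type) :
  ptrace_l (isotropic s) = (\tr s / 2) *: 1%:M.
Proof.
apply: entry_ext; elim/qubitP; elim/qubitP;
  by rewrite entry_opmx sum_qubit !entry_isotropic !entry_epr entryZ entry1 /=; field.
Qed.

Lemma isotropicE s : isotropic s =
  measure_prepare (epr R) (epr R) s + measure_prepare (1%:M - epr R) (@epr_compl R) s.
Proof.
by rewrite /isotropic /measure_prepare mulmxBl mul1mx raddfB.
Qed.

Lemma psd_1_epr : psd (1%:M - epr R).
Proof. by apply: psd_pure_compl; exact: tr_epr. Qed.

(** * Both kinds of box at once, from a reference vector [f] and a phase [z] on C *)

Section Box.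
Variables (mu : probability (U2_borel R) R) (mu_haar : is_haar mu) (C C' : finType).
Variable L : op R (qubit * qubit * C)%type -> op R (qubit * qubit * C')%type.
Variables (f : qubit * qubit * C -> R[i]) (z : C -> R[i]).
Hypotheses (locc_L : locc L) (L_f : ptrace_r (L (pure f)) = epr R).
Hypothesis (tr_f : \tr (pure f) = 1) (zz : forall c, z c * conj (z c) = 1).
(** A product operator takes [f] to A G B^T, and the phase [z] on C amounts to a Z to the right of
    the same G. *)
Hypothesis form : forall (al be : qubit -> qubit -> R[i]) (ga : C -> R[i]),
  exists G : qubit -> qubit -> R[i], forall x y,
     \sum_p al x p.1.1 * be y p.1.2 * ga p.2 * f p =
       \sum_a \sum_b al x a * G a b * be y b /\
     \sum_p al x p.1.1 * be y p.1.2 * ga p.2 * (z p.2 * f p) =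
       \sum_a \sum_b al x a * G a b * flip_sign R b * be y b.

Lemma twirledE : twirled mu L = fun rho => tens_id (@isotropic R) (L rho).
Proof.
by apply: funext => rho; apply: eq_tens_id => s; exact: twirl_isotropic.
Qed.

Let N rho : op R (qubit * qubit)%type := ptrace_r (twirled mu L rho).

Lemma ptrace_r_twirled rho : ptrace_r (twirled mu L rho) = isotropic (ptrace_r (L rho)).
Proof. by rewrite twirledE ptrace_r_tens_id //; exact: linear_isotropic. Qed.

Let NE rho : N rho = isotropic (ptrace_r (L rho)) := ptrace_r_twirled rho.

Let trL : trace_preserving L. Proof. by case: (locc_separable locc_L). Qed.

Let kraus_out : kraus (fun rho => ptrace_r (L rho)).
Proof.
apply: kraus_comp; first exact: kraus_ptrace_r.
by apply: separable_kraus; case: (locc_separable locc_L).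
Qed.

Let kraus_N : kraus N.
Proof.
apply: eq_kraus NE _; apply: (kraus_comp (F := @isotropic R)) kraus_out.
apply: eq_kraus isotropicE _; apply: krausD; apply: kraus_measure_prepare;
  [exact: psd_epr|exact: psd_epr|exact: psd_1_epr|exact: psd_epr_compl].
Qed.

Lemma twirled_box : locc (twirled mu L) /\ ptrace_r (twirled mu L (pure f)) = epr R.
Proof.
split; first by rewrite twirledE; exact: locc_isotropic.
by rewrite ptrace_r_twirled L_f isotropic_epr.
Qed.

Lemma twirled_achievable_le1 r : achievable N r -> r <= 1.
Proof.
(* [Nbar] makes the same measurement but prepares the opposite state, so together with [N] it emits
   E0 + E1 whatever the outcome. *)
pose Nbar rho : op R (qubit * qubit)%type :=
  measure_prepare (epr R) (@epr_compl R) (ptrace_r (L rho)) +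
  measure_prepare (1%:M - epr R) (epr R) (ptrace_r (L rho)).
apply: (@achievable_le1 R _ _ _ N Nbar (2^-1 *: (epr R + @epr_compl R))) => //.
- apply: (kraus_comp (F := fun s => measure_prepare (epr R) (@epr_compl R) s +
    measure_prepare (1%:M - epr R) (epr R) s)) kraus_out.
  by apply: krausD; apply: kraus_measure_prepare;
    [exact: psd_epr|exact: psd_epr_compl|exact: psd_1_epr|exact: psd_epr].
- apply: psdZ; first by rewrite invr_ge0.
  by apply: psdD; [exact: psd_epr|exact: psd_epr_compl].
- by rewrite mxtraceZ mxtraceD tr_epr tr_epr_compl; field.
move=> rho; rewrite NE isotropicE /Nbar /measure_prepare.
set s := ptrace_r _; have -> : \tr rho = \tr s by rewrite tr_ptrace_r trL.
rewrite mulmxBl mul1mx raddfB /=.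
move: (\tr (epr R *m s)) (\tr s) (epr R) (@epr_compl R) => a t E E1.
by apply: entry_ext => x y; rewrite !(entryD, entryZ); field.
Qed.

(** The twirl keeps the overlap with Psi+, so it is enough that the untwirled output has overlap 1
    for [f] and, by [separable_flip], 0 for the flipped input. *)
Lemma twirled_achievable1 : achievable N 1.
Proof.
have N_phi b : \tr (epr R *m N (pure (fun p => (if b then z p.2 else 1) * f p))) = (~~ b)%:R.
  rewrite NE epr_isotropic; case: b => /=; last first.
    rewrite (_ : (fun _ => _) = f) ?L_f ?epr_idem ?tr_epr //.
    by apply: funext => p; rewrite mul1r.
  have [sepL _] := locc_separable locc_L.
  apply: (separable_flip sepL trL form) => //.
  rewrite -[RHS]tr_f !tr_pure; apply: eq_bigr => p _.
  by rewrite rmorphM mulrACA zz mul1r.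
apply: (@achievable1 R _ _ _ N f z (epr R)) => //.
- exact: kraus_linear.
- exact: psd_epr.
- exact: psd_1_epr.
move=> b; rewrite mulmxBl mul1mx raddfB /= N_phi NE tr_isotropic tr_ptrace_r trL.
have -> : \tr (pure (fun p => (if b then z p.2 else 1) * f p)) = 1.
  rewrite -[RHS]tr_f !tr_pure; apply: eq_bigr => p _; case: b => /=; last by rewrite !mul1r.
  by rewrite rmorphM mulrACA zz mul1r.
by case: b; rewrite /= ?subr0 ?subrr.
Qed.

Lemma twirled_communication_value : communication_value (twirled mu L) = 1%:E.
Proof.
apply/eqP; rewrite eq_le; apply/andP; split.
  apply: ge_ereal_sup => _ [r ar <-]; rewrite lee_fin.
  exact: twirled_achievable_le1.
by apply: ereal_sup_ubound; exists 1 => //; exact: twirled_achievable1.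
Qed.

Let tr_out (G : op R C -> op R C) rho : channel G ->
  \tr (ptrace_r (L (actC G rho))) = \tr rho.
Proof. by move=> [_ tG]; rewrite tr_ptrace_r trL actCE tr_id_tens. Qed.

(** The marginal depends on the output only through its trace, which no channel on C changes. *)
Lemma twirled_not_signalling_CA : ~ signalling_CA (twirled mu L).
Proof.
move=> [rho [G0 [G1 [_ hG0 hG1]]]]; apply.
have e G : channel G -> ptrace_r (ptrace_r (twirled mu L (actC G rho))) =
    (\tr rho / 2) *: 1%:M.
  by move=> hG; rewrite ptrace_r_twirled ptrace_r_isotropic tr_out.
exact: etrans (e _ hG0) (esym (e _ hG1)).
Qed.

Lemma twirled_not_signalling_CB : ~ signalling_CB (twirled mu L).
Proof.
move=> [rho [G0 [G1 [_ hG0 hG1]]]]; apply.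
have e G : channel G -> ptrace_l (ptrace_r (twirled mu L (actC G rho))) =
    (\tr rho / 2) *: 1%:M.
  by move=> hG; rewrite ptrace_r_twirled ptrace_l_isotropic tr_out.
exact: etrans (e _ hG0) (esym (e _ hG1)).
Qed.
End Box.

(** * The two reference inputs and their phase flips *)

Definition es_amp (p : qubit * qubit * (qubit * qubit)) : R[i] :=
  epr_amp R (p.1.1, p.2.1) * epr_amp R (p.1.2, p.2.2).

Lemma es_inputE : es_input R = pure es_amp.
Proof. by congr pure; apply: funext => -[[a b] [c1 c2]]. Qed.

Definition ghz_amp (p : qubit * qubit * qubit) : R[i] :=
  if (p.1.1 == p.1.2) && (p.1.2 == p.2) then inv_sqrt2 R else 0.

Lemma ghzE : ghz R = pure ghz_amp.
Proof. by congr pure; apply: funext => -[[a b] c]. Qed.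

Lemma flip_sign_conj c : flip_sign R c * conj (flip_sign R c) = 1.
Proof. by rewrite /flip_sign; case: ifP => _; rewrite ?rmorphN rmorph1 ?mulrNN mulr1. Qed.

Lemma tr_es_amp : \tr (pure es_amp) = 1.
Proof.
have h2 := inv_sqrt2M R.
rewrite tr_pure !sum_pair !sum_qubit !sum_pair !sum_qubit /es_amp /epr_amp /=.
rewrite ?mul0r ?mulr0 ?rmorph0 ?mulr0 rmorphM /= !conj_inv_sqrt2 !h2.
by field.
Qed.

Lemma tr_ghz_amp : \tr (pure ghz_amp) = 1.
Proof.
rewrite tr_pure !sum_pair !sum_qubit /ghz_amp /=.
by rewrite ?rmorph0 ?mulr0 !conj_inv_sqrt2 !inv_sqrt2M; field.
Qed.

Lemma es_form (al be : qubit -> qubit -> R[i]) (ga : qubit * qubit -> R[i]) :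
  exists G : qubit -> qubit -> R[i], forall x y,
     \sum_p al x p.1.1 * be y p.1.2 * ga p.2 * es_amp p =
       \sum_a \sum_b al x a * G a b * be y b /\
     \sum_p al x p.1.1 * be y p.1.2 * ga p.2 * (flip_sign R p.2.2 * es_amp p) =
       \sum_a \sum_b al x a * G a b * flip_sign R b * be y b.
Proof.
have h2 := inv_sqrt2M R.
(* The EPR pairs identify C1 with A and C2 with B, so G is [ga] read as a matrix; the two amplitudes
   1 / sqrt 2 multiply to 1/2. *)
exists (fun a b => 2^-1 * ga (a, b)) => x y.
rewrite !sum_pair !sum_qubit !sum_pair !sum_qubit /es_amp /epr_amp /flip_sign /= !h2.
by split; rewrite ?mulr0 ?mul0r ?mulr0 ?addr0 ?add0r; field.
Qed.

Lemma ghz_form (al be : qubit -> qubit -> R[i]) (ga : qubit -> R[i]) :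
  exists G : qubit -> qubit -> R[i], forall x y,
     \sum_p al x p.1.1 * be y p.1.2 * ga p.2 * ghz_amp p =
       \sum_a \sum_b al x a * G a b * be y b /\
     \sum_p al x p.1.1 * be y p.1.2 * ga p.2 * (flip_sign R p.2 * ghz_amp p) =
       \sum_a \sum_b al x a * G a b * flip_sign R b * be y b.
Proof.
(* The GHZ correlations a = b = c make G diagonal. *)
exists (fun a b => if a == b then inv_sqrt2 R * ga a else 0) => x y.
rewrite !sum_pair !sum_qubit /ghz_amp /flip_sign /=.
by split; ring.
Qed.
End Boxes.

Theorem theorem4 (R : realType) (mu : probability (U2_borel R) R)
    (mu_haar : is_haar mu) (C' : finType) :
  (forall L : op R (qubit * qubit * (qubit * qubit))%type ->
              op R (qubit * qubit * C')%type,
     ES_box L ->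
     [/\ ES_box (twirled mu L),
         communication_value (twirled mu L) = 1%:E,
         ~ signalling_CA (twirled mu L) &
         ~ signalling_CB (twirled mu L)]) /\
  (forall L : op R (qubit * qubit * qubit)%type ->
              op R (qubit * qubit * C')%type,
     GHZ_EPR_box L ->
     [/\ GHZ_EPR_box (twirled mu L),
         communication_value (twirled mu L) = 1%:E,
         ~ signalling_CA (twirled mu L) &
         ~ signalling_CB (twirled mu L)]).
Proof.
split=> L; rewrite /ES_box /GHZ_EPR_box ?es_inputE ?ghzE => -[loccL Lf].
  split; [exact: twirled_box| |exact: twirled_not_signalling_CA
         |exact: twirled_not_signalling_CB].
  (* Charlie flips C2, the qubit paired with Bob, which puts the Z on Bob's side of G. *)
  apply: (@twirled_communication_value R mu mu_haar _ _ L (@es_amp R)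
    (fun c => flip_sign R c.2)) => //.
  - exact: tr_es_amp.
  - by move=> c; exact: flip_sign_conj.
  - exact: es_form.
split; [exact: twirled_box| |exact: twirled_not_signalling_CA
       |exact: twirled_not_signalling_CB].
apply: (@twirled_communication_value R mu mu_haar _ _ L (@ghz_amp R) (@flip_sign R)) => //.
- exact: tr_ghz_amp.
- exact: flip_sign_conj.
- exact: ghz_form.
Qed.
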